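(* Let $X$ be a real Banach space containing an isomorphic copy of $c_0$. Then there exists an equivalent norm $|\cdot|$ on $X$ such that $(X,|\cdot|)$ has the uniform diameter two property and such that, for every $\eta>0$, there is a convex combination of slices of the unit ball of $(X,|\cdot|)$ whose diameter (with respect to $|\cdot|$) is smaller than $\eta$.
   Context: All Banach spaces are real; $B_X$ denotes the closed unit ball of $X$ and $X^*$ its topological dual. A slice of a bounded set $C\subseteq X$ is a set $S(C,f,\alpha)=\{x\in C: f(x)>\sup f(C)-\alpha\}$ with $f\in X^*$ and $\alpha>0$. For a bounded convex set $C$, a convex combination of slices of $C$ is a set of the form $\sum_{i=1}^n\lambda_i S_i=\{\sum_{i=1}^n\lambda_i x_i: x_i\in S_i\}$, where $n\in\mathbb N$, $\lambda_1,\ldots,\lambda_n\in(0,1]$, $\sum_{i=1}^n\lambda_i=1$, and each $S_i$ is a slice of $C$. A Banach space $X$ has the diameter two property (D2P) if every non-empty relatively weakly open subset of $B_X$ has diameter two. Given a free ultrafilter $\mathcal U$ over $\mathbb N$, the ultrapower $X_{\mathcal U}$ is the quotient Banach space $\ell_\infty(\mathbb N,X)/c_{0,\mathcal U}(\mathbb N,X)$, where $\ell_\infty(\mathbb N,X)$ is the space of bounded sequences in $X$ with the supremum norm and $c_{0,\mathcal U}(\mathbb N,X)=\{(x_n)\in\ell_\infty(\mathbb N,X): \lim_{\mathcal U}\|x_n\|=0\}$; its norm is $\|[x_n]\|=\lim_{\mathcal U}\|x_n\|$. A Banach space $X$ has the uniform diameter two property (uniform D2P) if $X_{\mathcal U}$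 has the D2P for every free ultrafilter $\mathcal U$ over $\mathbb N$. *)

(* Defs.v *)
From HB Require Import structures.
From mathcomp Require Import all_boot all_order all_algebra.
From mathcomp Require Import all_classical all_reals all_analysis.

Set Implicit Arguments.
Unset Strict Implicit.
Unset Printing Implicit Defensive.

Import Order.TTheory GRing.Theory Num.Theory numFieldNormedType.Exports.

Local Open Scope classical_set_scope.
Local Open Scope ring_scope.
Local Open Scope quotient_scope.

Section geometry.
Context {R : realType}.
Implicit Type X : normedModType R.

Definition unit_ball X : set X := [set x | `|x| <= 1].
Arguments unit_ball : clear implicits.

(* Valued in the extended reals, so that an unbounded set has diameter +oo. *)
Definition diameter X (A : set X) : \bar R :=
  ereal_sup [set `|x - y|%:E | x in A & y in A].

Record dual X := Dual {
  dual_fun :> {linear X -> R^o};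
  dual_continuous : continuous dual_fun }.

Definition weak_topology X : topologicalType :=
  sup_topology (fun f : dual X => Topological.on (initial_topology (f : X -> R^o))).

Definition weakly_open X (A : set X) := open (A : set (weak_topology X)).

Definition D2P X := forall U : set X, weakly_open U ->
  unit_ball X `&` U !=set0 -> diameter (unit_ball X `&` U) = 2%:E.

Definition slice X (C : set X) (f : dual X) (alpha : R) : set X :=
  [set x | C x /\ f x > sup (f @` C) - alpha].

Definition is_slice X (C S : set X) :=
  exists f : dual X, exists2 alpha : R, 0 < alpha & S = slice C f alpha.

Definition convex_combination_of_slices X (C A : set X) :=
  exists (n : nat) (lambda : 'I_n -> R) (S : 'I_n -> set X),
    [/\ forall i, 0 < lambda i <= 1,
        \sum_i lambda i = 1,
        forall i, is_slice C (S i) &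
        A = [set \sum_i lambda i *: x i | x in [set x : 'I_n -> X | forall i, S i (x i)]]].

Definition contains_isomorphic_copy X (E : normedModType R) :=
  exists T : {linear E -> X}, exists c C : R,
    [/\ 0 < c, 0 < C & forall u, c * `|u| <= `|T u| <= C * `|u|].

End geometry.

Arguments unit_ball {R} X.
Arguments D2P {R} X.
Arguments contains_isomorphic_copy {R} X E.

Section equivalent_norm.
Context {R : realType}.

Record equivalent_norm (X : normedModType R) := EquivalentNorm {
  enorm :> X -> R;
  ler_enormD : forall x y, enorm (x + y) <= enorm x + enorm y;
  enormZ : forall (a : R) x, enorm (a *: x) = `|a| * enorm x;
  enorm_equiv : exists c C : R,
    [/\ 0 < c, 0 < C & forall x, c * `|x| <= enorm x <= C * `|x|] }.

Definition renormed (X : normedModType R) (N : equivalent_norm X) : Type := X.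

Context (X : normedModType R) (N : equivalent_norm X).

HB.instance Definition _ := GRing.Lmodule.copy (renormed N) X.

Lemma enorm0_eq0 (x : renormed N) : N x = 0 -> x = 0.
Proof.
have [c [C [c0 _ /(_ x)/andP[cx _]]]] := enorm_equiv N => Nx0.
apply/eqP; rewrite -(@normr_le0 R X) -(pmulr_rle0 _ c0).
by rewrite (le_trans cx)// Nx0.
Qed.

HB.instance Definition _ := @Lmodule_isNormed.Build R (renormed N) N
  (@ler_enormD X N) (@enormZ X N) enorm0_eq0.

End equivalent_norm.

Section linfty.
Context {R : realType}.

Definition bounded_seq (X : normedModType R) : {pred nat -> X} :=
  mem [set x : nat -> X | bounded_fun x].
Arguments bounded_seq : clear implicits.

Section linfty_def.
Context (X : normedModType R).

Lemma bounded_seqP (x : nat -> X) :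
  reflect (exists M, forall n, `|x n| <= M) (x \in bounded_seq X).
Proof.
have PF : ProperFilter (globally [set: nat]) := globally_properfilter (I : setT 0%N).
apply: (iffP (asboolP (bounded_fun x))); rewrite /= ex_bound => -[M xM].
  by exists M => n; exact: xM.
by exists M => n _; exact: xM.
Qed.

Lemma bounded_seq_submod_closed : submod_closed (bounded_seq X).
Proof.
split; first by apply/bounded_seqP; exists 0 => n; rewrite normr0.
move=> a x y /bounded_seqP[M xM] /bounded_seqP[M' yM'].
apply/bounded_seqP; exists (`|a| * M + M') => n /=.
rewrite (le_trans (ler_normD _ _))// lerD// normrZ.
by rewrite ler_wpM2l.
Qed.

HB.instance Definition _ := GRing.isSubmodClosed.Build R (nat -> X)
  (bounded_seq X) bounded_seq_submod_closed.

Record linfty := Linfty {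
  linfty_fun :> nat -> X;
  linfty_bounded : linfty_fun \in bounded_seq X }.

HB.instance Definition _ := [isSub for linfty_fun].
HB.instance Definition _ := [Choice of linfty by <:].
HB.instance Definition _ := [SubChoice_isSubLmodule of linfty by <:].

Definition linfty_norm (x : linfty) : R := sup [set `|x n| | n in [set: nat]].

Lemma linfty_has_sup (x : linfty) : has_sup [set `|x n| | n in [set: nat]].
Proof.
split; first by exists `|x 0%N|; exists 0%N.
have /bounded_seqP[M xM] := linfty_bounded x.
by exists M => _ [n _ <-].
Qed.

Lemma linfty_norm_ub (x : linfty) n : `|x n| <= linfty_norm x.
Proof. by apply: sup_upper_bound; [exact: linfty_has_sup|exists n]. Qed.

Lemma linfty_norm_le (x : linfty) M : (forall n, `|x n| <= M) -> linfty_norm x <= M.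
Proof.
move=> xM; apply: ge_sup; first by exists `|x 0%N|; exists 0%N.
by move=> _ [n _ <-].
Qed.

Lemma linftyD (x y : linfty) n : (x + y) n = x n + y n. Proof. by []. Qed.
Lemma linftyN (x : linfty) n : (- x) n = - x n. Proof. by []. Qed.
Lemma linftyZ (a : R) (x : linfty) n : (a *: x) n = a *: x n. Proof. by []. Qed.

Lemma linfty_normD x y : linfty_norm (x + y) <= linfty_norm x + linfty_norm y.
Proof.
apply: linfty_norm_le => n; rewrite linftyD (le_trans (ler_normD _ _))//.
by rewrite lerD// linfty_norm_ub.
Qed.

Lemma linfty_norm0_eq0 x : linfty_norm x = 0 -> x = 0.
Proof.
move=> x0; apply/val_inj/funext => n /=; apply/eqP.
by rewrite -normr_le0 -x0 linfty_norm_ub.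
Qed.

Lemma linfty_normZ (a : R) x : linfty_norm (a *: x) = `|a| * linfty_norm x.
Proof.
have leZ b y : linfty_norm (b *: y) <= `|b| * linfty_norm y.
  by apply: linfty_norm_le => n; rewrite linftyZ normrZ ler_wpM2l// linfty_norm_ub.
apply/eqP; rewrite eq_le leZ/=.
have [->|a0] := eqVneq a 0.
  by rewrite normr0 mul0r (le_trans _ (linfty_norm_ub _ 0%N)).
rewrite -ler_pdivlMl ?normr_gt0// -normfV.
by rewrite -[in leLHS](scalerK a0 x) leZ.
Qed.

HB.instance Definition _ := @Lmodule_isNormed.Build R linfty linfty_norm
  linfty_normD linfty_normZ linfty_norm0_eq0.

End linfty_def.

Definition c0_seq : {pred linfty R^o} := mem [set u : linfty R^o | u n @[n --> \oo] --> (0 : R)].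

Lemma c0_seqP (u : linfty R^o) : reflect (u n @[n --> \oo] --> (0 : R)) (u \in c0_seq).
Proof. by apply: (iffP idP); rewrite /c0_seq !inE. Qed.

Lemma c0_seq_submod_closed : submod_closed c0_seq.
Proof.
split; first by apply/c0_seqP; exact: cvg_cst.
move=> a u v /c0_seqP u0 /c0_seqP v0; apply/c0_seqP.
have := cvgD (cvgM (cvg_cst a) u0) v0.
by rewrite mulr0 addr0; apply.
Qed.

HB.instance Definition _ := GRing.isSubmodClosed.Build R (linfty R^o)
  c0_seq c0_seq_submod_closed.

Record c0 := C0 { c0_val :> linfty R^o; c0_cvg : c0_val \in c0_seq }.

HB.instance Definition _ := [isSub for c0_val].
HB.instance Definition _ := [Choice of c0 by <:].
HB.instance Definition _ := [SubChoice_isSubLmodule of c0 by <:].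

Definition c0_norm (u : c0) : R := `|c0_val u|.

Lemma c0_normD u v : c0_norm (u + v) <= c0_norm u + c0_norm v.
Proof. exact: ler_normD. Qed.

Lemma c0_normZ (a : R) u : c0_norm (a *: u) = `|a| * c0_norm u.
Proof. exact: normrZ. Qed.

Lemma c0_norm0_eq0 u : c0_norm u = 0 -> u = 0.
Proof. by move=> /normr0_eq0 u0; exact: val_inj. Qed.

HB.instance Definition _ := @Lmodule_isNormed.Build R c0 c0_norm
  c0_normD c0_normZ c0_norm0_eq0.

End linfty.

Arguments bounded_seq {R} X.
Arguments linfty {R} X.
Arguments c0 R : clear implicits.

Section ultrapower.
Context {R : realType}.

Context (X : normedModType R) (U : set_system nat) (UU : UltraFilter U).

Lemma ultra_norm_cvg (x : linfty X) : cvg (`|x n| @[n --> U]).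
Proof.
have Uball : (`|x n| @[n --> U]) `[0, `|x|]%classic.
  apply: (@filterS _ U _ [set: nat]) => [n _ /=|]; last exact: filterT.
  by rewrite in_itv/=; apply/andP; split; [exact: normr_ge0|exact: linfty_norm_ub].
have [p [_ clp]] := @segment_compact R 0 `|x| _ (fmap_proper_filter _ _) Uball.
apply/cvg_ex; exists p => V pV.
have [//|UnV] := in_ultra_setVsetC ((fun n => `|x n|) @^-1` V) UU.
by have [y [nVy Vy]] := clp (~` V) V UnV pV.
Qed.

(* The ultrafilter proof is an argument only so that the closure instances,
   which need it, can be attached to the predicate. *)
Definition c0U_pred (V : UltraFilter U) : {pred linfty X} :=
  mem [set x : linfty X | `|x n| @[n --> U] --> (0 : R)].

Local Notation c0U := (c0U_pred UU).

Lemma c0UP (x : linfty X) : reflect (`|x n| @[n --> U] --> (0 : R)) (x \in c0U).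
Proof. by apply: (iffP idP); rewrite /c0U_pred !inE. Qed.

Lemma c0U_submod_closed : submod_closed c0U.
Proof.
split.
  apply/c0UP; rewrite (_ : (fun n => _) = cst 0); first exact: cvg_cst.
  by apply/funext => n; rewrite normr0.
move=> a x y /c0UP x0 /c0UP y0; apply/c0UP.
apply: (@squeeze_cvgr _ _ _ _ (cst 0) (fun n => `|a| * `|x n| + `|y n|)).
- apply: nearW => n; apply/andP; split; first exact: normr_ge0.
  by rewrite -normrZ; exact: ler_normD.
- exact: cvg_cst.
- rewrite -[0 : R]addr0 -[X in X + _](mulr0 `|a|).
  by apply: cvgD y0; apply: cvgMr.
Qed.

HB.instance Definition _ := GRing.isSubmodClosed.Build R (linfty X)
  c0U c0U_submod_closed.

Definition ultrapower : Type := Quotient.quot c0U.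

HB.instance Definition _ := Choice.on ultrapower.
HB.instance Definition _ := EqQuotient.on ultrapower.
HB.instance Definition _ := GRing.Zmodule.on ultrapower.

(* upi x is the class [x_n] of the bounded sequence x. *)
Definition upi (x : linfty X) : ultrapower := \pi_ultrapower x.

Lemma upi_eqP (x y : linfty X) :
  upi x = upi y <-> (`|x n - y n| @[n --> U] --> (0 : R)).
Proof.
have xyE : (upi x == upi y) = (x - y \in c0U) by rewrite /upi (Quotient.idealrBE c0U).
split=> [/eqP|xy]; first by rewrite xyE => xy; exact/(c0UP (x - y)).
by apply/eqP; rewrite xyE; exact/(c0UP (x - y)).
Qed.

Lemma upi_repr (q : ultrapower) : upi (repr q) = q.
Proof. exact: reprK. Qed.

Lemma upiD (x y : linfty X) : upi (x + y) = upi x + upi y.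
Proof. exact: Quotient.pi_add. Qed.

Definition uscale (a : R) (q : ultrapower) : ultrapower := upi (a *: repr q).

Lemma upiZ (a : R) (x : linfty X) : upi (a *: x) = uscale a (upi x).
Proof.
apply/esym/upi_eqP; have /upi_eqP/(cvgM (cvg_cst `|a|)) := upi_repr (upi x).
rewrite mulr0; apply: cvg_trans; apply: near_eq_cvg; apply: nearW => n.
by rewrite /= -normrZ scalerBr.
Qed.

Lemma uscaleA (a b : R) q : uscale a (uscale b q) = uscale (a * b) q.
Proof. by rewrite -[q]upi_repr -!upiZ scalerA. Qed.

Lemma uscale1 : left_id 1 uscale.
Proof. by move=> q; rewrite -[q]upi_repr -!upiZ scale1r. Qed.

Lemma uscaleDr : right_distributive uscale +%R.
Proof.
move=> a p q; rewrite -[p]upi_repr -[q]upi_repr -upiD -!upiZ -upiD.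
by rewrite scalerDr.
Qed.

Lemma uscaleDl q : {morph uscale^~ q : a b / a + b}.
Proof. by move=> a b; rewrite -[q]upi_repr -!upiZ -upiD scalerDl. Qed.

HB.instance Definition _ := GRing.Zmodule_isLmodule.Build R ultrapower
  uscaleA uscale1 uscaleDr uscaleDl.

Definition unorm (q : ultrapower) : R := lim (`|(repr q : linfty X) n| @[n --> U]).

Lemma unorm_upi (x : linfty X) : unorm (upi x) = lim (`|x n| @[n --> U]).
Proof.
have /upi_eqP rx := upi_repr (upi x).
have d := cvgB (@ultra_norm_cvg (repr (upi x))) (@ultra_norm_cvg x).
apply/eqP; rewrite -subr_eq0; apply/eqP.
have d0 : (`|repr (upi x) n| - `|x n|) @[n --> U] --> (0 : R).
  apply: (@norm_cvg0 R R^o).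
  apply: (squeeze_cvgr _ _ rx); last exact: cvg_cst.
  by apply: nearW => n; rewrite normr_ge0; exact: ler_dist_dist.
exact: (cvg_unique (@Rhausdorff R) (d _) d0).
Qed.

Lemma unormD p q : unorm (p + q) <= unorm p + unorm q.
Proof.
rewrite -[p]upi_repr -[q]upi_repr -upiD !unorm_upi.
have cp := @ultra_norm_cvg (repr p); have cq := @ultra_norm_cvg (repr q).
rewrite -limD//; apply: ler_lim; first exact: ultra_norm_cvg.
- exact: is_cvgD.
- by apply: nearW => n; exact: ler_normD.
Qed.

Lemma unormZ (a : R) q : unorm (a *: q) = `|a| * unorm q.
Proof.
rewrite -[q]upi_repr -[a *: _]upiZ !unorm_upi.
have c := cvgM (cvg_cst `|a|) (@ultra_norm_cvg (repr q)).
apply: (cvg_lim (@Rhausdorff R)); apply: cvg_trans (c _ _).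
by apply: near_eq_cvg; apply: nearW => n; rewrite /= -normrZ.
Qed.

Lemma unorm0_eq0 q : unorm q = 0 -> q = 0.
Proof.
move=> q0; rewrite -[q]upi_repr -[RHS](_ : upi 0 = 0); last exact: raddf0.
apply/upi_eqP; rewrite -q0; apply: cvg_trans (@ultra_norm_cvg (repr q)).
by apply: near_eq_cvg; apply: nearW => n; rewrite /= subr0.
Qed.

HB.instance Definition _ := @Lmodule_isNormed.Build R ultrapower unorm
  unormD unormZ unorm0_eq0.

Lemma ultrapower_normE (x : linfty X) : `|upi x| = lim (`|x n| @[n --> U]).
Proof. exact: unorm_upi. Qed.

(* The ultralimit norm is the quotient norm of linfty X by c0U. *)
Lemma ultrapower_norm_inf (x : linfty X) :
  `|upi x| = inf [set `|x - y| | y in [set y | y \in c0U]].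
Proof.
have c00 : (0 : linfty X) \in c0U by exact: rpred0.
have lb y : y \in c0U -> `|upi x| <= `|x - y|.
  move=> /c0UP y0.
  have <- : upi (x - y) = upi x.
    apply/upi_eqP; move: y0; apply: cvg_trans; apply: near_eq_cvg.
    by apply: nearW => n /=; rewrite addrC addKr normrN.
  rewrite ultrapower_normE; apply: limr_le; first exact: ultra_norm_cvg.
  by apply: nearW => n; exact: linfty_norm_ub.
apply/eqP; rewrite eq_le; apply/andP; split.
  by apply: lb_le_inf; [exists `|x - 0|; exists 0|move=> _ [y yc <-]; exact: lb].
apply/ler_addgt0Pr => e e0.
have Ue : U [set n | `|x n| <= `|upi x| + e].
  have := @ultra_norm_cvg x; rewrite -ultrapower_normE => /cvgrPdist_lt /(_ e e0).
  apply: filterS => n /=; rewrite distrC => /ltW; rewrite ler_norml => /andP[_].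
  by rewrite lerBlDl.
pose yf n := if `|x n| <= `|upi x| + e then 0 else x n.
have yb : yf \in bounded_seq X.
  apply/bounded_seqP; exists `|x| => n; rewrite /yf; case: ifP => _.
    by rewrite normr0.
  exact: linfty_norm_ub.
have yc : Linfty yb \in c0U.
  apply/c0UP/cvgrPdist_lt => d d0; apply: filterS Ue => n /= xn.
  by rewrite /yf xn !normr0 subr0 normr0.
apply: (@le_trans _ _ `|x - Linfty yb|).
  by apply: ge_inf; [exists 0 => _ [z _ <-]|exists (Linfty yb)].
apply: linfty_norm_le => n; rewrite linftyD linftyN /= /yf.
by case: ifP => [xn|_]; rewrite ?subr0// subrr normr0 addr_ge0// ltW.
Qed.

End ultrapower.

(* An ultrafilter is free when its members have empty intersection. *)
Definition uniform_D2P (R : realType) (X : normedModType R) :=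
  forall (U : set_system nat) (UU : UltraFilter U),
    \bigcap_(A in U) A = set0 -> D2P (ultrapower X UU).

(* Main.v *)
Require Import Defs.
From HB Require Import structures.
From mathcomp Require Import all_boot all_order all_algebra.
From mathcomp Require Import all_classical all_reals all_analysis.
From mathcomp Require Import ring lra.
Set Implicit Arguments.
Unset Strict Implicit.
Unset Printing Implicit Defensive.
Import Order.TTheory GRing.Theory Num.Theory numFieldNormedType.Exports.
Local Open Scope classical_set_scope.
Local Open Scope ring_scope.

(** Let [e_0, e_1, ...] and [u] be the images in [X] of the unit vectors of [c0],
    the first of them being sent to [u]. Hahn-Banach gives functionals [psi] and
    [xi_k] on [X], uniformly bounded, with [xi_k e_j = delta_kj], [xi_k u = 0],
    [psi e_j = 0] and [psi u = 1]. Put [phi_k = psi + xi_k]. If [d] is the distance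
    to the closed span of the [e_k], then
<<
      M x = max (d x, 2 |psi x|, sup_k |phi_k x|)
>>
    is an equivalent norm in which each value [phi_k x] can be changed at will
    within [[- M x, M x]] by adding a multiple of [e_k] ([box_norm_update]).

    The new unit ball is the closed convex hull of [A], [- A] and the ball of [M],
    where [A] is the set of all [2 g - u] and [g] runs over a set [K] of finite
    combinations of the [e_k], with coordinates in [[0, 1]]. The set [K] is built
    along a tree: each index [k] has a finite list [children k] of smaller indices,
    [node k] is [e_k] plus the average of the nodes of its children, and [K]
    consists of all averages of nodes. Every finite list is the list of children of
    infinitely many indices. So for [g] in [K] there are infinitely many [k] such
    that [g + e_k] is in [K] too. A coordinate [xi_j (node k)] is the probability
    that a random descent from [k] to children visits [j].

    Uniform diameter two. The average of [2 g - u] and [u - 2 h] is [g - h], whose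
    [M]-norm is at most one. So every point of norm below [1 + eps] is within reach
    of [A] or of [- A] alone: it is [c (2 g - u) + y] with [|c| + M y < 1 + eps]. If
    [c >= 0], replacing [g] by [g + e_k] and moving [phi_k y] to the extreme values
    sends [phi_k] to [1 + eps], and moving only [phi_k y] sends it to [- (1 + eps)]
    ([renorm_flip]). This happens for infinitely many [k], and the increments are
    multiples of distinct [e_k]. Taken coordinatewise in an ultrapower, they form
    sequences dominated by the basis of [c0], hence weakly null there. So every weak neighbourhood of a point of the ball of the ultrapower
    contains two points of the ball at distance two ([uniform_D2P_flip]).

    Small combinations of slices. On [A] the functional [xi_k] reaches [2], on the
    ball of [M] it is at most [3 / 2], and on [- A] it is at most [0]. So a thin slice
    given by [xi_k] consists of points close to some [2 g - u] with [g] in [K] and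
    [xi_k g] close to [1] ([slice_near_apex]). Take [k] childless. A random descent
    that visits [k] with probability at least [1 - delta] visits [j <> k] with
    probability at most [delta + xi_k (node j)], and the sum of [xi_k (node j)] over
    childless [k] is at most one. Hence the average over [n] childless indices of
    such [g] is determined, up to [delta + 1 / n] in each coordinate
    ([leaf_slices_mean]). *)

(** * Sublinear functionals and the Hahn-Banach theorem *)

Section sublinear.
Context {R : realType} {X : lmodType R}.
Implicit Types (p : X -> R) (x y : X).

Definition sublinear p :=
  (forall x y, p (x + y) <= p x + p y) /\
  (forall a x, 0 <= a -> p (a *: x) = a * p x).

Lemma sublinear0 p : sublinear p -> p 0 = 0.
Proof. by case=> _ /(_ 0 0 (lexx _)); rewrite scale0r mul0r. Qed.

Lemma sublinearN_ge p x : sublinear p -> - p (- x) <= p x.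
Proof.
move=> sp; have := sp.1 x (- x); rewrite subrr sublinear0// => h.
by rewrite -subr_ge0 opprK.
Qed.

Lemma sublinear_normZ p : sublinear p -> (forall x, p (- x) <= p x) ->
  forall a x, p (a *: x) = `|a| * p x.
Proof.
move=> sp pN a x; have pNE y : p (- y) = p y.
  by apply/eqP; rewrite eq_le pN -{1}[y]opprK pN.
have [a0|a0] := leP 0 a; first by rewrite sp.2 ?ger0_norm.
have na0 : 0 <= - a by rewrite oppr_ge0 ltW.
by rewrite -pNE -scaleNr sp.2// ltr0_norm.
Qed.

(** Infima of families of functions produce all the auxiliary sublinear
    functionals below: the lower bound of a chain, the extension of a functional
    off a subspace, the distance to a subspace, and the gauge of the new ball. *)
Definition inf_fun (I : Type) (F : I -> X -> R) x := inf (range (F^~ x)).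

Section inf_fun.
Context (I : Type) (F : I -> X -> R).
Context (F_lb : forall x, exists m, forall i, m <= F i x).

Lemma inf_fun_le i x : inf_fun F x <= F i x.
Proof.
have [m mF] := F_lb x; apply: ge_inf; last by exists i.
by exists m => _ [j _ <-].
Qed.

Lemma inf_fun_ge m x : I -> (forall i, m <= F i x) -> m <= inf_fun F x.
Proof.
by move=> i mF; apply: lb_le_inf; [exists (F i x), i|move=> _ [j _ <-]].
Qed.

Lemma inf_fun_lt r x : I -> inf_fun F x < r -> exists i, F i x < r.
Proof.
by move=> i /inf_lt[|_ [j _ <-] jr]; [exists (F i x), i|exists j].
Qed.

(** The error term [e] lets a family be closed under addition only
    approximately, which is the case for the gauge of a set that is convex only
    up to closure. *)
Lemma inf_fun_sublinear :
  (exists i, F i 0 <= 0) ->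
  (forall i j x y e, 0 < e -> exists k, F k (x + y) <= F i x + F j y + e) ->
  (forall i a x, 0 < a -> exists j, F j (a *: x) <= a * F i x) ->
  sublinear (inf_fun F).
Proof.
move=> [i0 Fi0] FD FZ.
have leZ a x : 0 < a -> inf_fun F (a *: x) <= a * inf_fun F x.
  move=> a0; rewrite -ler_pdivrMl//; apply: inf_fun_ge => // i.
  rewrite ler_pdivrMl//; have [j] := FZ i a x a0.
  exact/le_trans/inf_fun_le.
have le0 : inf_fun F 0 = 0.
  apply/eqP; rewrite eq_le (le_trans (inf_fun_le i0 0))//=.
  have := @leZ 2 0; rewrite scaler0 => /(_ ltac:(lra)); lra.
split=> [x y|a x].
  apply/ler_addgt0Pr => e e0.
  have e20 : 0 < e / 4 by lra.
  have [i Fi] : exists i, F i x < inf_fun F x + e / 4.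
    by apply: (inf_fun_lt i0); rewrite ltrDl.
  have [j Fj] : exists i, F i y < inf_fun F y + e / 4.
    by apply: (inf_fun_lt i0); rewrite ltrDl.
  have [k Fk] := FD i j x y _ e20.
  apply: (le_trans (inf_fun_le k _)); lra.
rewrite le_eqVlt => /predU1P[<-|a0]; first by rewrite scale0r mul0r.
apply/eqP; rewrite eq_le leZ//= -ler_pdivlMl//.
have := @leZ a^-1 (a *: x); rewrite invr_gt0 scalerA mulVf ?gt_eqF// scale1r.
exact.
Qed.

End inf_fun.

(** For fixed [y], the functional [x |-> inf_(t >= 0) (p (x + t y) - t p y)] is
    sublinear and below [p]. If [p] is minimal, then it is [p] itself, and [t = 1]
    gives [p x + p y <= p (x + y)]. *)
Lemma minimal_sublinear_linear p : sublinear p ->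
  (forall q : X -> R, sublinear q -> (forall x, q x <= p x) -> q = p) ->
  linear (p : X -> R^o).
Proof.
move=> sp pmin.
have pD x y : p (x + y) = p x + p y.
  apply/eqP; rewrite eq_le sp.1/=.
  pose F (t : {t : R | 0 <= t}) z := p (z + val t *: y) - val t * p y.
  have F_lb z : exists m, forall t, m <= F t z.
    exists (- p (- z)) => -[t t0]; rewrite /F /=.
    have := sp.1 (z + t *: y) (- z); rewrite addrC addrA addNr add0r.
    by rewrite sp.2//; lra.
  pose t0 : {t : R | 0 <= t} := exist _ 0 (lexx 0).
  have F0 z : F t0 z = p z by rewrite /F /= scale0r mul0r subr0 addr0.
  have sF : sublinear (inf_fun F).
    apply: inf_fun_sublinear => //.
    - by exists t0; rewrite F0 sublinear0 ?lexx.
    - move=> [s s0] [t t1] z w e e0; exists (exist _ (s + t) (addr_ge0 s0 t1)).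
      rewrite /F/= scalerDl addrACA; have := sp.1 (z + s *: y) (w + t *: y).
      by lra.
    - move=> [t t1] a z a0; exists (exist _ (a * t) (mulr_ge0 (ltW a0) t1)).
      by rewrite /F/= -scalerA -scalerDr (sp.2 _ _ (ltW a0)) -mulrA mulrBr.
  have <- := pmin _ sF (fun z => le_trans (inf_fun_le F_lb t0 z) _); last first.
    by move=> z; rewrite F0.
  have := inf_fun_le F_lb (exist _ 1 ler01) x.
  rewrite (pmin _ sF) => [|z]; last by rewrite -F0 inf_fun_le.
  by rewrite /F/= scale1r mul1r; lra.
move=> a x y; rewrite pD; congr (_ + _).
have pN z : p (- z) = - p z.
  by apply/eqP; rewrite -addr_eq0 -pD addNr sublinear0.
have [a0|a0] := leP 0 a; first by rewrite sp.2.
have na0 : 0 <= - a by rewrite oppr_ge0 ltW.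
by rewrite -[a]opprK scaleNr pN (sp.2 _ _ na0) -mulNr.
Qed.

(** Zorn's lemma gives a minimal sublinear functional below [p]. Working with
    sublinear functionals on the whole space avoids partially defined maps. *)
Theorem hahn_banach p : sublinear p ->
  exists f : {linear X -> R^o}, forall x, f x <= p x.
Proof.
move=> sp.
pose T := {q : X -> R | sublinear q /\ forall x, q x <= p x}.
pose le (q r : T) : bool := `[< forall x, sval r x <= sval q x >].
have [|r s t /asboolP rs /asboolP st|[q Pq] [r Pr] /asboolP qr /asboolP rq||q qmin] :=
  @Zorn T le.
- by move=> q; apply/asboolP.
- by apply/asboolP => x; exact: le_trans (st x) (rs x).
- apply: eq_exist; apply/funext => x; apply/eqP.
  by rewrite eq_le; apply/andP; split; [exact: rq|exact: qr].
- move=> A tA.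
  have [[q0 Aq0]|A0] := pselect (exists t, A t); last first.
    exists (exist _ p (conj sp (fun x => lexx _))) => q Aq.
    by case: A0; exists q.
  pose F (q : {t | A t}) := sval (sval q).
  have F_lb x : exists m, forall q, m <= F q x.
    exists (- p (- x)) => -[[q [sq qp]] Aq]; rewrite /F/=.
    by rewrite (le_trans _ (sublinearN_ge _ sq))// lerN2.
  have sF : sublinear (inf_fun F).
    apply: inf_fun_sublinear => //.
    - by exists (exist _ q0 Aq0); rewrite /F /= sublinear0//; case: (svalP q0).
    - move=> [q Aq] [r Ar] x y e e0.
      have [/asboolP qr|/asboolP rq] := tA _ _ Aq Ar.
      + exists (exist _ r Ar); rewrite /F/=.
        have [sr _] := svalP r; have := sr.1 x y; have := qr x; lra.
      + exists (exist _ q Aq); rewrite /F/=.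
        have [sq _] := svalP q; have := sq.1 x y; have := rq y; lra.
    - move=> [q Aq] a x a0; exists (exist _ q Aq); rewrite /F/=.
      by have [sq _] := svalP q; rewrite (sq.2 _ _ (ltW a0)).
  have Fp x : inf_fun F x <= p x.
    rewrite (le_trans (inf_fun_le F_lb (exist _ q0 Aq0) x))// /F/=.
    by case: (svalP q0).
  exists (exist _ (inf_fun F) (conj sF Fp)) => q Aq; apply/asboolP => x /=.
  exact: (inf_fun_le F_lb (exist _ q Aq)).
have [sq qp] := svalP q.
have lq : linear (sval q : X -> R^o).
  apply: minimal_sublinear_linear => // r sr rq.
  have Pr : sublinear r /\ forall x, r x <= p x.
    by split=> // x; exact: le_trans (rq x) (qp x).
  by rewrite -(qmin (exist _ r Pr))//; apply/asboolP.
pose L := GRing.isLinear.Build R X R^o *:%R (sval q) lq.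
pose f : {linear X -> R^o} := HB.pack (sval q : X -> R^o) L.
by exists f.
Qed.

End sublinear.

(** A functional on a subspace, given through an embedding [T], is extended by
    applying [hahn_banach] to [x |-> inf_v (D |x - T v| + g v)]: a linear map
    below it is at most [g] on the range of [T], hence equal to [g] there. *)
Lemma hahn_banach_extension {R : realType} (E X : normedModType R)
    (T : {linear E -> X}) (g : {linear E -> R^o}) (D : R) :
  0 <= D -> (forall v, `|g v : R| <= D * `|T v|) ->
  exists f : {linear X -> R^o},
    (forall v, f (T v) = g v) /\ forall x, `|f x : R| <= D * `|x|.
Proof.
move=> D0 gD; pose F (v : E) (x : X) : R := D * `|x - T v| + g v.
have F_lb x : exists m, forall v, m <= F v x.
  exists (- (D * `|x|)) => v; rewrite /F.
  have := gD v; have : D * `|T v| <= D * `|x - T v| + D * `|x|.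
    rewrite -mulrDr ler_wpM2l// distrC.
    by rewrite (le_trans _ (ler_normD _ _))// subrK.
  by rewrite ler_norml; lra.
have sF : sublinear (inf_fun F).
  apply: inf_fun_sublinear => //.
  - by exists 0; rewrite /F !linear0 !addr0 normr0 mulr0.
  - move=> v w x y eps eps0; exists (v + w).
    rewrite /F (linearD T) (linearD g) opprD addrACA.
    have := ler_wpM2l D0 (ler_normD (x - T v) (y - T w)).
    by rewrite mulrDr; lra.
  - move=> v b x b0; exists (b *: v).
    rewrite /F (linearZ _ _ : T _ = _) (linearZ _ _ : g _ = _) -scalerBr normrZ.
    by rewrite (gtr0_norm b0) mulrCA -mulrDr.
have [f fF] := hahn_banach sF.
have fT v : f (T v) <= g v :> R.
  have := le_trans (fF (T v)) (inf_fun_le F_lb v (T v)).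
  by rewrite /F subrr normr0 mulr0 add0r.
have fD x : f x <= D * `|x| :> R.
  have := le_trans (fF x) (inf_fun_le F_lb 0 x).
  by rewrite /F !linear0 !addr0.
exists f; split=> [v|x].
  apply/eqP; rewrite eq_le fT/=; have := fT (- v).
  by rewrite (linearN T) (linearN f) (linearN g) lerN2.
by rewrite ler_norml fD andbT lerNl -linearN (le_trans (fD _))// normrN.
Qed.


(** * A tree on the natural numbers *)

(** The 2-adic valuation of [k] codes a list, so that each list has infinitely many
    codes; the filter makes the tree well-founded. *)
Definition children (k : nat) : seq nat :=
  [seq i <- odflt [::] (unpickle (logn 2 k)) | (i < k)%N].

(** The [j]-th of infinitely many indices whose list of children is [s]. The term
    [sumn s] puts it above all entries of [s], so that the filter in [children] keeps
    them all. *)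
Definition attach (s : seq nat) (j : nat) : nat :=
  (2 ^ pickle s * (2 * (sumn s + j)).+1)%N.

Lemma children_lt k i : i \in children k -> (i < k)%N.
Proof. by rewrite mem_filter => /andP[]. Qed.

Lemma leq_attach s j : (sumn s + j < attach s j)%N.
Proof.
apply: (@leq_trans (2 * (sumn s + j)).+1); first by rewrite ltnS leq_pmull.
by rewrite leq_pmull// expn_gt0.
Qed.

Lemma attach_gt s j i : i \in s -> (i < attach s j)%N.
Proof.
move=> /perm_to_rem/perm_sumn sE; apply: leq_ltn_trans (leq_attach s j).
by rewrite sE/= -addnA leq_addr.
Qed.

Lemma children_attach s j : children (attach s j) = s.
Proof.
have logE : logn 2 (attach s j) = pickle s.
  rewrite lognM ?expn_gt0// pfactorK// logn_coprime ?addn0//.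
  by rewrite coprime2n/= mul2n odd_double.
rewrite /children logE pickleK/=; apply/all_filterP/allP => i.
exact: attach_gt.
Qed.

Lemma attach_inj s : injective (attach s).
Proof.
move=> i j /eqP; rewrite eqn_pmul2l ?expn_gt0// eqSS eqn_pmul2l//.
by rewrite eqn_add2l => /eqP.
Qed.

(** * Averages of nodes and their coordinates *)

Section nodes.
Context {R : realType} {V : lmodType R} (e : nat -> V).

(** The list of the first [n] nodes, which encodes a course-of-values recursion. *)
Fixpoint nodes n : seq V :=
  if n is m.+1 then
    let c := [seq (nodes m)`_i | i <- children m] in
    rcons (nodes m) (e m + (size c)%:R^-1 *: \sum_(x <- c) x)
  else [::].

Definition node k := (nodes k.+1)`_k.

Definition avg (s : seq nat) := (size s)%:R^-1 *: \sum_(i <- s) node i.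

Lemma size_nodes n : size (nodes n) = n.
Proof. by elim: n => //= n IH; rewrite size_rcons IH. Qed.

Lemma nth_nodes n i : (i < n)%N -> (nodes n)`_i = node i.
Proof.
elim: n => // n IH; rewrite ltnS leq_eqVlt => /predU1P[->//|ni] /=.
by rewrite nth_rcons size_nodes ni IH.
Qed.

Lemma nodeE k : node k = e k + avg (children k).
Proof.
rewrite /node /= nth_rcons size_nodes ltnn eqxx size_map big_map /avg.
congr (_ + _ *: _); apply: eq_big_seq => i /children_lt ik.
by rewrite nth_nodes.
Qed.

Lemma avgE s : avg s = (size s)%:R^-1 *: \sum_(i <- s) node i.
Proof. by []. Qed.

Lemma avg1 k : avg [:: k] = node k.
Proof. by rewrite avgE big_seq1 invr1 scale1r. Qed.

Lemma avg_nil : avg [::] = 0.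
Proof. by rewrite /avg big_nil scaler0. Qed.

Lemma node_leaf k : children k = [::] -> node k = e k.
Proof. by rewrite nodeE => ->; rewrite avg_nil addr0. Qed.

Lemma node_ind (P : V -> Prop) : P 0 -> (forall x y, P x -> P y -> P (x + y)) ->
  (forall a x, P x -> P (a *: x)) -> (forall k, P (e k)) ->
  forall k, P (node k).
Proof.
move=> P0 PD PZ Pe; elim/ltn_ind => k IH; rewrite nodeE; apply: (PD _ _ (Pe k)).
by apply: PZ; rewrite big_seq; elim/big_ind: _ => // i /children_lt; exact: IH.
Qed.

Lemma avg_ind (P : V -> Prop) : P 0 -> (forall x y, P x -> P y -> P (x + y)) ->
  (forall a x, P x -> P (a *: x)) -> (forall k, P (e k)) ->
  forall s, P (avg s).
Proof.
move=> P0 PD PZ Pe s; have Pnode := node_ind P0 PD PZ Pe.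
by apply: PZ; elim/big_ind: _.
Qed.

(** The pattern of all coordinate estimates: an affine inequality that holds at the
    nodes of [s] holds at their average. *)
Lemma mean_le (F : nat -> R) s b : s != [::] -> (forall i, i \in s -> F i <= b) ->
  (size s)%:R^-1 * \sum_(i <- s) F i <= b.
Proof.
move=> s0 Fb; rewrite ler_pdivrMl ?ltr0n ?lt0n ?size_eq0//.
have -> : (size s)%:R * b = \sum_(i <- s) b.
  by rewrite big_const_seq count_predT iter_addr addr0 mulr_natl.
rewrite big_seq [leRHS]big_seq; exact: ler_sum.
Qed.

Lemma linear_avg (f : {linear V -> R^o}) s :
  f (avg s) = (size s)%:R^-1 * \sum_(i <- s) (f (node i) : R).
Proof. by rewrite /avg linearZ linear_sum. Qed.

Context (xi : nat -> {linear V -> R^o}).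
Context (xi_e : forall j k, xi j (e k) = (j == k)%:R).

Lemma coord_node_gt j k : (k < j)%N -> xi j (node k) = 0.
Proof.
elim/ltn_ind: k => k IH kj; rewrite nodeE linearD/= xi_e gtn_eqF// add0r.
rewrite linear_avg big1_seq ?mulr0// => i /andP[_ /children_lt ik].
by rewrite IH// (ltn_trans ik).
Qed.

Lemma coord_node_diag k : xi k (node k) = 1.
Proof.
rewrite nodeE linearD/= xi_e eqxx linear_avg big1_seq ?mulr0 ?addr0//.
by move=> i /andP[_ /children_lt ik]; rewrite coord_node_gt.
Qed.

Lemma coord_node j k : j != k -> xi j (node k) = xi j (avg (children k)).
Proof. by move=> jk; rewrite nodeE linearD/= xi_e (negbTE jk) add0r. Qed.

Lemma coord_node_ge0 j k : 0 <= xi j (node k).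
Proof.
elim/ltn_ind: k => k IH; have [->|jk] := eqVneq j k.
  by rewrite coord_node_diag ler01.
rewrite coord_node// linear_avg mulr_ge0// big_seq sumr_ge0// => i.
by move=> /children_lt; exact: IH.
Qed.

Lemma coord_avg_ge0 j s : 0 <= xi j (avg s).
Proof.
by rewrite linear_avg mulr_ge0// sumr_ge0// => i _; exact: coord_node_ge0.
Qed.

Lemma coord_node_le1 j k : xi j (node k) <= 1.
Proof.
elim/ltn_ind: k => k IH; have [->|jk] := eqVneq j k.
  by rewrite coord_node_diag.
rewrite coord_node//; have [->|c0] := eqVneq (children k) [::].
  by rewrite avg_nil linear0 ler01.
rewrite linear_avg; apply: mean_le => // i /children_lt; exact: IH.
Qed.

Lemma coord_avg_le1 j s : xi j (avg s) <= 1.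
Proof.
have [->|s0] := eqVneq s [::]; first by rewrite avg_nil linear0 ler01.
by rewrite linear_avg; apply: mean_le => // i _; exact: coord_node_le1.
Qed.

Lemma coord_avg_attach s j : xi (attach s j) (avg s) = 0.
Proof.
rewrite linear_avg big1_seq ?mulr0// => i /andP[_ si].
by rewrite coord_node_gt// attach_gt.
Qed.

Let leaf := attach [::].

Let leafP i : children (leaf i) = [::]. Proof. exact: children_attach. Qed.

(** A descent stops at the first childless index that it meets, so the events of
    visiting distinct childless indices are disjoint. *)
Lemma sum_leaf_node_le1 N m : \sum_(i < N) (xi (leaf i) (node m) : R) <= 1.
Proof.
elim/ltn_ind: m => m IH.
have [m0|m0] := eqVneq (children m) [::].
  rewrite node_leaf//.
  have [/existsP[i /eqP im]|] := boolP [exists i : 'I_N, leaf i == m].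
    rewrite (bigD1 i)//= xi_e im eqxx big1 ?addr0// => j ji.
    by rewrite xi_e -im (inj_eq (@attach_inj _)) val_eqE (negbTE ji).
  rewrite negb_exists => /forallP im; rewrite big1 ?ler01// => i _.
  by rewrite xi_e (negbTE (im i)).
rewrite (eq_bigr (fun i : 'I_N => (size (children m))%:R^-1 *
    \sum_(k <- children m) (xi (leaf i) (node k) : R))) => [|i _]; last first.
  rewrite coord_node ?linear_avg//; apply: contra_neq m0 => <-; exact: leafP.
rewrite -mulr_sumr exchange_big; apply: mean_le => // k /children_lt.
exact: IH.
Qed.

(** The product is the probability of visiting [j] and then missing [k]; since [k]
    is childless, no descent visits [k] before [j]. *)
Lemma leaf_node_le j k m : children k = [::] -> j != k ->
  xi j (node m) * (1 - xi k (node j)) + xi k (node m) <= 1 :> R.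
Proof.
move=> k0 jk; elim/ltn_ind: m => m IH.
have [<-|jm] := eqVneq j m; first by rewrite coord_node_diag mul1r subrK.
have [<-|km] := eqVneq k m.
  by rewrite node_leaf// !xi_e (negbTE jk) eqxx mul0r add0r.
rewrite (coord_node jm) (coord_node km); have [->|m0] := eqVneq (children m) [::].
  by rewrite avg_nil !linear0 mul0r add0r ler01.
rewrite !linear_avg -mulrA mulr_suml -mulrDr -big_split /=.
by apply: mean_le => // i /children_lt; exact: IH.
Qed.

Lemma leaf_avg_le j k s : s != [::] -> children k = [::] -> j != k ->
  xi j (avg s) * (1 - xi k (node j)) + xi k (avg s) <= 1 :> R.
Proof.
move=> s0 k0 jk; rewrite !linear_avg -mulrA mulr_suml -mulrDr -big_split /=.
by apply: mean_le => // i _; exact: leaf_node_le.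
Qed.

(** Writing [p] for [xi j (avg s)] and [th] for [xi k (node j)], [leaf_avg_le] gives
    [p (1 - th) <= delta], hence [p <= delta + p th <= delta + th]; the same holds for
    [t], and both coordinates are nonnegative. *)
Lemma leaf_slice_coord j k s t (delta : R) : 0 <= delta ->
    s != [::] -> t != [::] -> children k = [::] ->
    1 - delta <= xi k (avg s) -> 1 - delta <= xi k (avg t) ->
  `|(xi j (avg s) : R) - xi j (avg t)| <= delta + xi k (node j).
Proof.
move=> d0 s0 t0 k0 ks kt.
have := coord_avg_ge0 j s; have := coord_avg_ge0 j t.
have := coord_avg_le1 j s; have := coord_avg_le1 j t.
have [->|jk] := eqVneq j k; first by rewrite coord_node_diag ler_norml; lra.
have := leaf_avg_le s0 k0 jk; have := leaf_avg_le t0 k0 jk.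
have := coord_node_ge0 k j; have := coord_node_le1 k j.
move: ks kt; move: (xi j (avg s) : R) (xi j (avg t) : R) (xi k (node j) : R).
move=> x y th; rewrite ler_norml; nra.
Qed.

(** The errors [xi k (node j)] of [leaf_slice_coord] do not shrink with [delta], but
    by [sum_leaf_node_le1] they contribute at most one in total: dividing by [N] makes
    them negligible. *)
Lemma leaf_slices_mean (N : nat) (s t : 'I_N -> seq nat) (delta : R) (j : nat) :
    0 <= delta -> (forall i, s i != [::]) -> (forall i, t i != [::]) ->
    (forall i : 'I_N, 1 - delta <= xi (leaf i) (avg (s i))) ->
    (forall i : 'I_N, 1 - delta <= xi (leaf i) (avg (t i))) ->
  \sum_(i < N) `|(xi j (avg (s i)) : R) - xi j (avg (t i))| <= N%:R * delta + 1.
Proof.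
move=> d0 s0 t0 sd td.
apply: (@le_trans _ _ (\sum_(i < N) (delta + xi (leaf i) (node j)))).
  by apply: ler_sum => i _; exact: leaf_slice_coord.
rewrite big_split/= sumr_const card_ord -[delta *+ N]mulr_natl lerD2l.
exact: sum_leaf_node_le1.
Qed.

End nodes.

(** * A norm with independent coordinates *)

(** What is used of a copy of [c0] in [X]. The vectors [vec k] and [top] play the
    roles of the unit vectors and of the constant sequence one in the space of
    convergent sequences, with [limit] as the limit functional; [dist] is a seminorm
    that measures the distance to the span of the [vec k]. *)
Record c0_frame {R : realType} (X : normedModType R) := C0Frame {
  vec : nat -> X;
  top : X;
  coord : nat -> {linear X -> R^o};
  limit : {linear X -> R^o};
  dist : X -> R;
  coord_vec : forall j k, coord j (vec k) = (j == k)%:R;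
  coord_top : forall j, coord j top = 0;
  limit_vec : forall k, limit (vec k) = 0;
  limit_top : limit top = 1;
  distD : forall x y, dist (x + y) <= dist x + dist y;
  distZ : forall a x, dist (a *: x) = `|a| * dist x;
  dist_vec : forall k, dist (vec k) = 0;
  frame_bound : exists2 C : R, 0 < C & forall x, [/\ dist x <= C * `|x|,
    `|limit x : R| <= C * `|x| & forall j, `|coord j x : R| <= C * `|x|];
  frame_coercive : exists2 C : R, 0 < C & forall x r, dist x <= r ->
    `|limit x : R| <= r -> (forall j, `|coord j x : R| <= r) -> `|x| <= C * r }.

Section frame_norm.
Context {R : realType} {X : normedModType R} (F : c0_frame X).
Implicit Types (x y w : X) (s t : seq nat) (c m : R).

Local Notation e := (vec F).
Local Notation u := (top F).
Local Notation xi := (coord F).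
Local Notation psi := (limit F).
Local Notation avg := (avg (vec F)).

(** The [j]-th term of the sequence for which [top] is the constant one: [coord]
    subtracts the limit from it. *)
Definition phi j x : R := psi x + xi j x.

Lemma phiD j x y : phi j (x + y) = phi j x + phi j y.
Proof. by rewrite /phi !linearD addrACA. Qed.

Lemma phiZ j a x : phi j (a *: x) = a * phi j x.
Proof. by rewrite /phi !linearZ/= mulrDr. Qed.

Lemma phiB j x y : phi j (x - y) = phi j x - phi j y.
Proof. by rewrite -scaleN1r phiD phiZ mulN1r. Qed.

Lemma phi_vec j k : phi j (e k) = (j == k)%:R.
Proof. by rewrite /phi limit_vec coord_vec add0r. Qed.

Lemma phi_top j : phi j u = 1.
Proof. by rewrite /phi limit_top coord_top addr0. Qed.

(** The factor [2] makes [coord] at most [3 / 2] on the unit ball, strictly below its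
    value [2] at the points that define the slices. *)
Definition box_norm x : R :=
  Num.max (dist F x) (Num.max (2 * `|psi x : R|) (sup [set `|phi j x| | j in setT])).

Lemma phi_has_sup x : has_sup [set `|phi j x| | j in setT].
Proof.
split; first by exists `|phi 0%N x|; exists 0%N.
have [C C0 /(_ x)[_ psiC xiC]] := frame_bound F.
exists (C * `|x| + C * `|x|) => _ [j _ <-].
by rewrite (le_trans (ler_normD _ _))// lerD.
Qed.

Lemma box_normP x m : reflect
  [/\ dist F x <= m, 2 * `|psi x : R| <= m & forall j, `|phi j x| <= m]
  (box_norm x <= m).
Proof.
apply: (iffP idP); rewrite /box_norm !ge_max.
  move=> /and3P[xm pm sm]; split=> // j; apply: le_trans sm.
  by apply: sup_upper_bound; [exact: phi_has_sup|exists j].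
move=> [-> -> phim] /=; apply: ge_sup; first by exists `|phi 0%N x|; exists 0%N.
by move=> _ [j _ <-].
Qed.

Lemma box_normD x y : box_norm (x + y) <= box_norm x + box_norm y.
Proof.
have /box_normP[dx px fx] := lexx (box_norm x).
have /box_normP[dy py fy] := lexx (box_norm y).
apply/box_normP; split.
- by rewrite (le_trans (distD _ _ _))// lerD.
- by rewrite linearD (le_trans _ (lerD px py))// -mulrDr ler_wpM2l// ler_normD.
- by move=> j; rewrite phiD (le_trans (ler_normD _ _))// lerD.
Qed.

Lemma box_normZ a x : box_norm (a *: x) = `|a| * box_norm x.
Proof.
have leZ b y : box_norm (b *: y) <= `|b| * box_norm y.
  have /box_normP[dy py fy] := lexx (box_norm y).
  apply/box_normP; split.
  - by rewrite distZ ler_wpM2l.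
  - by rewrite linearZ/= normrM mulrCA ler_wpM2l.
  - by move=> j; rewrite phiZ normrM ler_wpM2l.
apply/eqP; rewrite eq_le leZ/=.
have [->|a0] := eqVneq a 0.
  by rewrite normr0 mul0r (le_trans (normr_ge0 (phi 0 (0 *: x))))//;
    have /box_normP[_ _ ->] := lexx (box_norm (0 *: x)).
rewrite -ler_pdivlMl ?normr_gt0// -normfV.
by rewrite -[in leLHS](scalerK a0 x) leZ.
Qed.

Lemma box_normN x : box_norm (- x) = box_norm x.
Proof. by rewrite -scaleN1r box_normZ normrN1 mul1r. Qed.

Lemma box_norm_ge0 x : 0 <= box_norm x.
Proof.
by have /box_normP[_ _ /(_ 0%N)] := lexx (box_norm x); exact: le_trans.
Qed.

Lemma box_norm0 : box_norm 0 = 0.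
Proof. by rewrite -[0](scale0r 0) box_normZ normr0 mul0r. Qed.

Lemma phi_le_box j x : `|phi j x| <= box_norm x.
Proof. by have /box_normP[_ _] := lexx (box_norm x); exact. Qed.

Lemma coord_le_box j x : `|xi j x : R| <= 3 / 2 * box_norm x.
Proof.
have /box_normP[_ px /(_ j)] := lexx (box_norm x); rewrite /phi.
move: px; rewrite ler_norml => ? /andP[? ?].
by move: (ler_norm (psi x : R)) (ler_norm (- psi x : R)); rewrite normrN ler_norml; lra.
Qed.

Lemma box_norm_equiv : exists c C : R,
  [/\ 0 < c, 0 < C & forall x, c * `|x| <= box_norm x <= C * `|x|].
Proof.
have [C C0 FC] := frame_bound F; have [D D0 FD] := frame_coercive F.
exists (2 * D)^-1, (2 * C); split; [by rewrite invr_gt0 mulr_gt0|by rewrite mulr_gt0|].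
move=> x; rewrite ler_pdivrMl ?mulr_gt0//.
have /box_normP[dx px fx] := lexx (box_norm x); have M0 := box_norm_ge0 x.
apply/andP; split.
  rewrite mulrAC -mulrA mulrC -mulrA mulrCA; apply: FD; [lra| |].
    by have := normr_ge0 (psi x : R); lra.
  by move=> j; have := coord_le_box j x; lra.
have [Cd Cp Cx] := FC x; have x0 := normr_ge0 x.
have Cx0 : 0 <= C * `|x| by rewrite mulr_ge0// ltW.
apply/box_normP; split; [lra|lra|move=> j].
by rewrite (le_trans (ler_normD _ _))//; have := Cx j; lra.
Qed.

(** The vectors on which [box_norm] is the supremum of the coordinates. *)
Definition null w := dist F w = 0 /\ psi w = 0.

Lemma dist_ge0 w : 0 <= dist F w.
Proof.
have := distD F w (- w); rewrite subrr -[- w]scaleN1r distZ normrN1 mul1r.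
by rewrite -[X in dist F X](scale0r 0) distZ normr0 mul0r; lra.
Qed.

Lemma nullD w w' : null w -> null w' -> null (w + w').
Proof.
move=> [dw pw] [dw' pw']; split; last by rewrite linearD pw pw' addr0.
apply/eqP; rewrite eq_le dist_ge0 andbT.
by rewrite (le_trans (distD _ _ _))// dw dw' addr0.
Qed.

Lemma nullZ a w : null w -> null (a *: w).
Proof.
move=> [dw pw]; split; first by rewrite distZ dw mulr0.
by rewrite linearZ/= pw scaler0.
Qed.

Lemma null0 : null 0.
Proof.
by split; rewrite ?linear0// -[0](scale0r 0) distZ normr0 mul0r.
Qed.

Lemma null_vec k : null (e k).
Proof. by split; [exact: dist_vec|exact: limit_vec]. Qed.

Lemma null_avg s : null (avg s).
Proof.
apply: avg_ind; [exact: null0|exact: nullD|exact: nullZ|exact: null_vec].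
Qed.

Lemma nullN w : null w -> null (- w).
Proof. by rewrite -scaleN1r; exact: nullZ. Qed.

Lemma box_norm_null w m : null w -> 0 <= m -> (forall j, `|xi j w : R| <= m) ->
  box_norm w <= m.
Proof.
move=> [dw pw] m0 xm; apply/box_normP; split; rewrite ?dw ?pw ?normr0 ?mulr0//.
by move=> j; rewrite /phi pw add0r.
Qed.

(** Adding a multiple of [e k] changes neither [dist], nor [limit], nor any [phi j] with
    [j <> k]. *)
Lemma box_norm_update y m (k : nat) (t : R) : box_norm y <= m -> `|t| <= m ->
  box_norm (y + (t - phi k y) *: e k) <= m.
Proof.
move=> /box_normP[dy py fy] tm; apply/box_normP; split.
- rewrite (le_trans (distD _ _ _))// distZ dist_vec mulr0 addr0//.
- by rewrite linearD linearZ/= limit_vec scaler0 addr0.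
- move=> j; rewrite phiD phiZ phi_vec; have [->|_] := eqVneq j k.
    by rewrite mulr1 addrC subrK.
  by rewrite mulr0 addr0.
Qed.

(** The sequence [e] spans an isometric copy of the finitely supported vectors of
    [c0]. *)
Lemma box_norm_sum (k : nat -> nat) (a : nat -> R) n m : injective k -> 0 <= m ->
  (forall j, `|a j| <= m) -> box_norm (\sum_(j < n) a j *: e (k j)) <= m.
Proof.
move=> kinj m0 am; apply: box_norm_null => //.
  elim/big_ind: _ => [||j _]; [exact: null0|exact: nullD|].
  by apply: nullZ; exact: null_vec.
move=> i; rewrite linear_sum.
under eq_bigr do rewrite linearZ/= coord_vec -[_ *: _]/(_ * _).
have [/existsP[j /eqP ij]|] := boolP [exists j : 'I_n, i == k j].
  rewrite (bigD1 j)//= ij eqxx mulr1 big1 ?addr0// => l lj.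
  by rewrite (inj_eq kinj) eq_sym val_eqE (negbTE lj) mulr0.
rewrite negb_exists => /forallP ik; rewrite big1 ?normr0// => j _.
by rewrite (negbTE (ik j)) mulr0.
Qed.

Lemma box_norm_avgB s t : box_norm (avg s - avg t) <= 1.
Proof.
apply: box_norm_null => // [|j].
  by apply: nullD; [|apply: nullN]; exact: null_avg.
rewrite linearB/=.
have := coord_avg_ge0 (coord_vec F) j s; have := coord_avg_ge0 (coord_vec F) j t.
have := coord_avg_le1 (coord_vec F) j s; have := coord_avg_le1 (coord_vec F) j t.
by rewrite ler_norml; lra.
Qed.

Lemma box_norm_avg s : box_norm (avg s) <= 1.
Proof. by have := box_norm_avgB s [::]; rewrite avg_nil subr0. Qed.

(** In the [phi] coordinates the averages, with values in [[0, 1]], become points with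
    values in [[-1, 1]]. *)
Definition apex s := 2 *: avg s - u.

Lemma apexE s : apex s = 2 *: avg s - u.
Proof. by []. Qed.

Lemma phi_apex j s : phi j (apex s) = 2 * xi j (avg s) - 1.
Proof.
by rewrite phiB phiZ phi_top /phi; have [_ ->] := null_avg s; rewrite add0r.
Qed.

Lemma phi_apex_le1 j s : `|phi j (apex s)| <= 1.
Proof.
rewrite phi_apex ler_norml.
have := coord_avg_ge0 (coord_vec F) j s; have := coord_avg_le1 (coord_vec F) j s.
by lra.
Qed.

Lemma coord_apex j s : xi j (apex s) = 2 * xi j (avg s) :> R.
Proof. by rewrite linearB linearZ/= coord_top subr0. Qed.

Lemma box_norm_apex s : box_norm (apex s) <= 2 + box_norm u.
Proof.
rewrite (le_trans (box_normD _ _))// box_normN lerD2r box_normZ ger0_norm//.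
by have := box_norm_avg s; lra.
Qed.

Lemma apexB s t : apex s - apex t = 2 *: (avg s - avg t).
Proof. by rewrite /apex opprB addrA subrK scalerBr. Qed.

(** A rational weight [i / n] is realised by repeating the lists, and the averages lie
    at mutual distance at most one. *)
Lemma avg_convex_approx c c' s t (eps : R) : 0 <= c -> 0 <= c' ->
    s != [::] -> t != [::] -> 0 < eps ->
  exists2 r, r != [::] &
    box_norm (c *: avg s + c' *: avg t - (c + c') *: avg r) <= eps.
Proof.
move=> c0 c'0 s0 t0 e0.
have [cc0|cc0] := eqVneq (c + c') 0.
  have -> : c = 0 by lra.
  have -> : c' = 0 by lra.
  by exists s => //; rewrite addr0 !scale0r addr0 subr0 box_norm0 ltW.
have {}cc0 : 0 < c + c' by rewrite lt_def cc0 addr_ge0.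
pose n := (Num.trunc ((c + c') / eps)).+1.
have n0 : (0 < n)%N by [].
have nR0 : (0 : R) < n%:R by rewrite ltr0n.
have nP : (c + c') / n%:R <= eps.
  rewrite ler_pdivrMr// mulrC -ler_pdivrMr// ltW//.
  by rewrite truncnS_gt.
pose lam := c / (c + c').
have lam01 : 0 <= lam <= 1.
  rewrite /lam ler_pdivrMr// mul1r lerDl c'0 andbT.
  by apply: divr_ge0 => //; exact: ltW.
pose i := Num.trunc (lam * n%:R).
have [/andP[lam0 lam1] il] : 0 <= lam <= 1 /\ i%:R <= lam * n%:R < i.+1%:R.
  by split=> //; apply: truncn_itv; rewrite mulr_ge0//; case/andP: lam01.
have in_ : (i <= n)%N.
  rewrite -(ler_nat R) (le_trans (proj1 (andP il)))//.
  by rewrite ler_piMl// ltW.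
(* The factors size t and size s compensate for the different lengths of s and t. *)
pose r := flatten (nseq (i * size t) s) ++ flatten (nseq ((n - i) * size s) t).
have sumr : \sum_(k <- r) node e k = (i * size t)%:R *: \sum_(k <- s) node e k
    + ((n - i) * size s)%:R *: \sum_(k <- t) node e k.
  have flat_sum l q : \sum_(k <- flatten (nseq l q)) node e k
      = l%:R *: \sum_(k <- q) node e k.
    elim: l => [|l IH] /=; first by rewrite big_nil scale0r.
    by rewrite big_cat IH -[in RHS]natr1 scalerDl scale1r addrC.
  by rewrite big_cat /= !flat_sum.
have sizer : size r = (n * (size s * size t))%N.
  have flat_size l (q : seq nat) : size (flatten (nseq l q)) = (l * size q)%N.
    by rewrite size_flatten /shape map_nseq sumn_nseq mulnC.
  rewrite size_cat !flat_size -mulnA -[X in (_ + X)%N]mulnA [(size t * _)%N]mulnC -mulnDl.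
  by rewrite subnKC.
have sR : (size s)%:R != 0 :> R by rewrite pnatr_eq0 size_eq0.
have tR : (size t)%:R != 0 :> R by rewrite pnatr_eq0 size_eq0.
exists r.
  by rewrite -size_eq0 sizer !muln_eq0 !size_eq0 !negb_or s0 t0.
have avgr : avg r = (i%:R / n%:R) *: avg s + (1 - i%:R / n%:R) *: avg t.
  rewrite avgE sumr sizer !scalerDr !scalerA; congr (_ *: _ + _ *: _).
    by rewrite !natrM; field; rewrite sR tR gt_eqF.
  by rewrite !natrM natrB//; field; rewrite sR tR gt_eqF.
have -> : c *: avg s + c' *: avg t - (c + c') *: avg r
    = ((c + c') * (lam - i%:R / n%:R)) *: (avg s - avg t).
  rewrite avgr; move: (i%:R / n%:R) (avg s) (avg t) => q v w.
  rewrite scalerDr !scalerA opprD addrACA -!scalerBl scalerBr -scaleNr.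
  by congr (_ *: _ + _ *: _); rewrite /lam; field; rewrite gt_eqF.
rewrite box_normZ (le_trans (ler_piMr _ (box_norm_avgB _ _)))//.
rewrite (le_trans _ nP)// normrM (gtr0_norm cc0) ler_pM2l//.
have nV : 0 < n%:R^-1 :> R by rewrite invr_gt0.
have [il1 il2] : i%:R / n%:R <= lam /\ lam < i%:R / n%:R + n%:R^-1.
  case/andP: il => il1 il2; rewrite ler_pdivrMr//; split=> //.
  by rewrite -[X in _ + X]mul1r -mulrDl natr1 ltr_pdivlMr.
by rewrite ler_norml; lra.
Qed.

End frame_norm.

(** * The new norm *)

Section renorming.
Context {R : realType} {X : normedModType R} (F : c0_frame X).
Implicit Types (x y w : X) (s t : seq nat) (c m : R).

Local Notation e := (vec F).
Local Notation xi := (coord F).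
Local Notation avg := (avg (vec F)).
Local Notation apex := (apex F).
Local Notation phi := (phi F).
Local Notation box_norm := (box_norm F).

(** [renorm] is the gauge of the convex hull of the points [apex s], their opposites
    and the unit ball of [box_norm]. One coefficient [c], of either sign, is enough: by
    [apex_combine] a combination of points of both kinds is absorbed by the ball of
    [box_norm]. *)
Definition gauge (i : {cs : R * seq nat | cs.2 != [::]}) x : R :=
  `|(val i).1| + box_norm (x - (val i).1 *: apex (val i).2).

Definition renorm x : R := inf_fun gauge x.

Lemma gauge_lb x : exists m, forall i, m <= gauge i x.
Proof. by exists 0 => i; rewrite addr_ge0 ?box_norm_ge0. Qed.

Lemma renorm_le c s x : s != [::] ->
  renorm x <= `|c| + box_norm (x - c *: apex s).
Proof.
move=> s0; pose i : {cs : R * seq nat | cs.2 != [::]} := exist _ (c, s) s0.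
exact: (inf_fun_le gauge_lb i).
Qed.

Let i0 : {cs : R * seq nat | cs.2 != [::]} :=
  exist (fun cs : R * seq nat => cs.2 != [::]) (0, [:: 0%N]) isT.

Lemma renorm_lt x m : renorm x < m -> exists c s, s != [::] /\
  `|c| + box_norm (x - c *: apex s) < m.
Proof. by move=> /(inf_fun_lt i0)[[[c s] s0]] /= h; exists c, s. Qed.

Lemma renorm_ge0 x : 0 <= renorm x.
Proof.
by apply: (inf_fun_ge i0) => i; rewrite addr_ge0 ?box_norm_ge0.
Qed.

Lemma renorm_le_box x : renorm x <= box_norm x.
Proof.
by have := @renorm_le 0 [:: 0%N] x isT; rewrite normr0 add0r scale0r subr0.
Qed.

(** If [c] and [c'] have the same sign, then [avg_convex_approx] merges the two points.
    If [0 <= - c' <= c], then [apex s - apex t], which is twice a difference of averages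
    and so has [box_norm] at most two, takes up the weight [- c'] of both points. *)
Lemma apex_combine c c' s t (eps : R) : s != [::] -> t != [::] -> 0 < eps ->
  exists d r, r != [::] /\
    `|d| + box_norm (c *: apex s + c' *: apex t - d *: apex r)
      <= `|c| + `|c'| + eps.
Proof.
move=> s0 t0 e0.
wlog cc : c c' s t s0 t0 / `|c'| <= `|c|.
  move=> H; have [cc|/ltW cc] := leP `|c'| `|c|; first exact: H.
  by have [d [r [r0 h]]] := H _ _ _ _ t0 s0 cc; exists d, r; split=> //;
    rewrite [c *: _ + _]addrC [`|c| + _]addrC.
wlog c0 : c c' cc / 0 <= c.
  move=> H; have [c0|c0] := leP 0 c; first exact: H.
  have [||d [r [r0]]] := H (- c) (- c'); [by rewrite !normrN|by rewrite oppr_ge0 ltW|].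
  rewrite !normrN !scaleNr -opprD -(box_normN F) opprB opprK => h.
  exists (- d), r; split=> //; rewrite normrN scaleNr opprK.
  by rewrite [_ + d *: _]addrC.
have [c'0|c'0] := leP 0 c'.
  have e20 : 0 < eps / 2 by lra.
  have [r r0 rle] := avg_convex_approx F c0 c'0 s0 t0 e20.
  exists (c + c'), r; split=> //; rewrite !ger0_norm ?addr_ge0// lerD2l.
  rewrite scalerDl opprD addrACA -!scalerBr !apexB.
  move: rle; rewrite scalerDl opprD addrACA -!scalerBr.
  move: (avg s - _) (avg t - _) => v w vw.
  rewrite !scalerA ![_ * 2]mulrC -!scalerA -scalerDr box_normZ ger0_norm//; lra.
exists (c + c'), s; split=> //.
have -> : c *: apex s + c' *: apex t - (c + c') *: apex s =
    (- c' * 2) *: (avg s - avg t).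
  rewrite scalerDl [c *: _ + c' *: _]addrC opprD addrA addrK -scalerBr -opprB.
  by rewrite apexB scalerN -scaleNr scalerA.
rewrite box_normZ; move: cc; rewrite normrM normrN.
rewrite (ltr0_norm c'0) (ger0_norm c0) [`|2|]ger0_norm// => cc.
rewrite ger0_norm; last by lra.
have := ler_piMr _ (box_norm_avgB F s t); move=> /(_ (- c' * 2)) ?.
have ? : (- c' * 2) * box_norm (avg s - avg t) <= - c' * 2.
  by apply: ler_piMr (box_norm_avgB F s t); lra.
lra.
Qed.

Lemma renorm_sublinear : sublinear renorm.
Proof.
apply: inf_fun_sublinear; first exact: gauge_lb.
- by exists i0; rewrite /gauge /= scale0r subr0 normr0 box_norm0 addr0.
- move=> [[c s] s0] [[c' t] t0] x y eps eps0; rewrite /gauge/=.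
  have [d [r [r0 dr]]] := apex_combine c c' s0 t0 eps0.
  exists (exist _ (d, r) r0); rewrite /=.
  have -> : x + y - d *: apex r = (x - c *: apex s) + (y - c' *: apex t) +
      (c *: apex s + c' *: apex t - d *: apex r).
    by rewrite [x - _ + _]addrACA -opprD addrA subrK.
  have := box_normD F (x - c *: apex s + (y - c' *: apex t))
    (c *: apex s + c' *: apex t - d *: apex r).
  have := box_normD F (x - c *: apex s) (y - c' *: apex t).
  by move: dr => /=; lra.
- move=> [[c s] s0] a x a0; exists (exist _ (a * c, s) s0); rewrite /gauge/=.
  by rewrite -scalerA -scalerBr box_normZ normrM (gtr0_norm a0) mulrDr.
Qed.

Lemma renorm_le_opp x : renorm (- x) <= renorm x.
Proof.
apply: (inf_fun_ge i0) => -[[c s] s0]; rewrite /gauge /=.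
rewrite (le_trans (@renorm_le (- c) s (- x) s0))// normrN scaleNr -opprD.
by rewrite box_normN.
Qed.

Lemma renormN x : renorm (- x) = renorm x.
Proof.
by apply/eqP; rewrite eq_le renorm_le_opp -{1}[x]opprK renorm_le_opp.
Qed.

Lemma renormD x y : renorm (x + y) <= renorm x + renorm y.
Proof. exact: renorm_sublinear.1. Qed.

Lemma renormZ a x : renorm (a *: x) = `|a| * renorm x.
Proof. exact: (sublinear_normZ renorm_sublinear renorm_le_opp). Qed.

Lemma box_le_renorm x : box_norm x <= (2 + box_norm (top F)) * renorm x.
Proof.
have u0 := box_norm_ge0 F (top F).
rewrite -ler_pdivrMl; last by lra.
apply: (inf_fun_ge i0) => -[[c s] s0]; rewrite /gauge /= ler_pdivrMl; last by lra.
have := box_normD F (x - c *: apex s) (c *: apex s); rewrite subrK box_normZ.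
have := ler_wpM2l (normr_ge0 c) (box_norm_apex F s).
have := box_norm_ge0 F (x - c *: apex s); nra.
Qed.

Lemma renorm_equiv : exists c C : R,
  [/\ 0 < c, 0 < C & forall x, c * `|x| <= renorm x <= C * `|x|].
Proof.
have [c [C [c0 C0 cC]]] := box_norm_equiv F.
have K0 : 0 < 2 + box_norm (top F) by have := box_norm_ge0 F (top F); lra.
exists ((2 + box_norm (top F))^-1 * c), C; split=> // [|x].
  by rewrite mulr_gt0 ?invr_gt0.
have /andP[cx Cx] := cC x.
rewrite -mulrA ler_pdivrMl// (le_trans cx (box_le_renorm x))/=.
by rewrite (le_trans (renorm_le_box x)).
Qed.

Definition c0_renorming : equivalent_norm X :=
  EquivalentNorm renormD renormZ renorm_equiv.

Lemma phi_le_renorm j x : `|phi j x| <= renorm x.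
Proof.
apply: (inf_fun_ge i0) => -[[c s] s0]; rewrite /gauge /=.
rewrite -[x in phi j x](subrK (c *: apex s)) phiD phiZ addrC.
rewrite (le_trans (ler_normD _ _))// lerD ?phi_le_box//.
by rewrite normrM ler_piMr// phi_apex_le1.
Qed.

(** This is how the tree lets a point of the generating set move by [2 *: e k] inside
    that set. *)
Lemma apex_attach s j :
  apex [:: attach s j] = apex s + 2 *: e (attach s j).
Proof.
have avg_attach : avg [:: attach s j] = avg s + e (attach s j).
  by rewrite avg1 nodeE children_attach addrC.
by rewrite !apexE avg_attach scalerDr addrAC.
Qed.

(** In a decomposition [x = c *: apex s + y] with [c >= 0], the value of [phi k] is
    [- c] on the first term. It is kept at [- c], or moved to [c] by passing from [s] to
    [[:: k]], while [phi k y] is moved to an extreme value of the same sign. *)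
Lemma renorm_flip x (eps : R) : renorm x < 1 + eps ->
  exists s, forall j, let k := attach s j in
    renorm (x + (1 + eps - phi k x) *: e k) <= 1 + eps /\
    renorm (x - (1 + eps + phi k x) *: e k) <= 1 + eps.
Proof.
move=> /renorm_lt[c [s [s0 h]]]; exists s => j k.
wlog c0 : c x h / 0 <= c.
  move=> H; have [c0|c0] := leP 0 c; first exact: H _ _ h c0.
  have [||] := H (- c) (- x).
  - by rewrite normrN scaleNr -opprD box_normN.
  - by rewrite oppr_ge0 ltW.
  have -> : phi k (- x) = - phi k x by rewrite -scaleN1r phiZ mulN1r.
  rewrite opprK -opprD renormN => h1 h2; split=> //.
  by rewrite -renormN opprB addrC.
move: h; rewrite (ger0_norm c0); set y := x - c *: apex s => h.
have y0 := box_norm_ge0 F y.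
have xE : x = y + c *: apex s by rewrite subrK.
have phix : phi k x = phi k y - c.
  by rewrite xE phiD phiZ phi_apex coord_avg_attach ?mulr0 ?sub0r ?mulrN1//;
    exact: coord_vec.
have ym : box_norm y <= 1 + eps - c by lra.
have m0 : `|1 + eps - c| <= 1 + eps - c by rewrite ger0_norm//; lra.
split.
  apply: (le_trans (@renorm_le c [:: k] _ isT)); rewrite ger0_norm//.
  rewrite apex_attach -/k scalerDr scalerA.
  have -> : x + (1 + eps - phi k x) *: e k - (c *: apex s + (c * 2) *: e k) =
      y + (1 + eps - c - phi k y) *: e k.
    rewrite phix; move: (phi k y) => p.
    by rewrite [- (_ *: _ + _)]opprD addrACA -scalerBl; congr (_ + _ *: _); lra.
  by have := box_norm_update k ym m0; lra.
apply: (le_trans (@renorm_le c s _ s0)); rewrite ger0_norm//.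
have -> : x - (1 + eps + phi k x) *: e k - c *: apex s =
    y + (- (1 + eps - c) - phi k y) *: e k.
  rewrite phix; move: (phi k y) => p.
  by rewrite addrAC -[- (_ *: e k)]scaleNr; congr (_ + _ *: _); lra.
have := @box_norm_update _ _ F y _ k (- (1 + eps - c)) ym.
by rewrite normrN => /(_ m0); lra.
Qed.

(** For [x = c *: apex s + y] with [|c| + box_norm y < 1 + delta], the value [xi k x] is
    at most [2 * Num.max c 0 + 3 / 2 * box_norm y]. It can exceed [2 - delta] only if [c]
    is close to one, [y] is small and [xi k (avg s)] is close to one. *)
Lemma slice_near_apex k x (delta : R) : 0 < delta -> delta < 5^-1 ->
  renorm x <= 1 -> 2 - delta < xi k x -> exists s, [/\ s != [::],
    1 - 6 * delta <= xi k (avg s) &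
    renorm (x - apex s) <= (20 + 7 * box_norm (top F)) * delta].
Proof.
move=> d0 d1 x1 kx; have {x1} : renorm x < 1 + delta by lra.
move=> /renorm_lt[c [s [s0]]]; set y := x - c *: apex s => h; exists s.
have xE : x = y + c *: apex s by rewrite subrK.
have y0 := box_norm_ge0 F y; have u0 := box_norm_ge0 F (top F).
have := coord_le_box F k y; rewrite ler_norml => /andP[_ yk].
have g0 := coord_avg_ge0 (coord_vec F) k s.
have g1 := coord_avg_le1 (coord_vec F) k s.
have {}kx : 2 - delta < xi k y + c * (2 * xi k (avg s)).
  by move: kx; rewrite [in X in _ < X]xE linearD linearZ/= coord_apex.
move: (xi k y : R) (xi k (avg s) : R) yk g0 g1 kx => a g ya g0 g1 kx.
have c0 : 0 <= c.
  by rewrite leNgt; apply/negP => c0; move: h; rewrite (ltr0_norm c0); nra.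
move: h; rewrite (ger0_norm c0) => h.
have cg : c * g <= c by rewrite ler_piMr.
have s6 : 1 + delta - c < 6 * delta by lra.
split=> //.
  have : 1 - 5 * delta < c * g by lra.
  have := ler_wpM2r g0 (ltW (_ : c < 1 + delta)); nra.
have -> : x - apex s = y + (c - 1) *: apex s.
  by rewrite xE scalerBl scale1r addrA.
rewrite (le_trans (renormD _ _))//.
have := renorm_le_box y; have := renorm_le_box (apex s); rewrite renormZ.
have := box_norm_apex F s; have := renorm_ge0 (apex s).
have : `|c - 1| <= 7 * delta by rewrite ler_norml; lra.
have := normr_ge0 (c - 1); nra.
Qed.

End renorming.

(** * Weakly null sequences and ultrapowers *)

Section weak_topology.
Context {R : realType} {X : normedModType R}.

Lemma weakly_open_cvg (W : set X) (x : X) (v : nat -> X) :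
    weakly_open W -> W x ->
    (forall f : dual X, (f (v j) : R^o) @[j --> \oo] --> (f x : R^o)) ->
  \forall j \near \oo, W (v j).
Proof.
move=> Wop Wx fv.
have : v j @[j --> \oo] --> (x : weak_topology X).
  apply/cvg_sup => f A /= [_ [[B Bop <-] Bfx BA]].
  have : nbhs (f x : R^o) B by apply: open_nbhs_nbhs; split.
  move=> /fv fB; apply: (@filterS _ \oo _ [set j | B (f (v j))]) fB => j; exact: BA.
have : nbhs (x : weak_topology X) W by apply: open_nbhs_nbhs; split.
by move=> xW vx; exact: vx.
Qed.

Lemma dual_bounded (f : dual X) : exists2 C : R, 0 < C & forall x, `|f x : R| <= C * `|x|.
Proof.
have /linear_boundedP/pinfty_ex_gt0[C C0 fC] :=
  @continuous_linear_bounded _ _ _ 0 _ (@dual_continuous _ _ f 0).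
by exists C.
Qed.

(** With the signs of [f (v j)] as coefficients, the bound says that the series of
    [|f (v j)|] has bounded partial sums. *)
Lemma c0_sequence_weakly_null (v : nat -> X) (C : R) :
  (forall (a : nat -> R) n, (forall j, `|a j| <= 1) ->
    `|\sum_(j < n) a j *: v j| <= C) ->
  forall f : dual X, (f (v j) : R^o) @[j --> \oo] --> (0 : R^o).
Proof.
move=> vC f; have [D D0 fD] := dual_bounded f.
pose g j : R := `|f (v j) : R|.
have : cvgn (series g).
  apply: nondecreasing_is_cvgn.
    by apply/nondecreasing_seqP => n; rewrite /series/= big_nat_recr//= lerDl normr_ge0.
  exists (D * C) => _ [n _ <-]; rewrite /series/= big_mkord.
  pose a j := Num.sg (f (v j) : R).
  have -> : \sum_(j < n) g j = f (\sum_(j < n) a j *: v j).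
    rewrite linear_sum; apply: eq_bigr => j _.
    by rewrite linearZ/= /g /a -[_ *: _]/(_ * _) -normrEsg.
  rewrite (le_trans (ler_norm _))// (le_trans (fD _))// ler_wpM2l ?(ltW D0)//.
  by apply: vC => j; rewrite /a normr_sg lern1 leq_b1.
by move=> /cvg_series_cvg_0 /norm_cvg0.
Qed.

End weak_topology.

(** A free ultrafilter contains the complement of each singleton. *)
Lemma free_ultrafilter_oo (U : set_system nat) : UltraFilter U ->
  \bigcap_(A in U) A = set0 -> forall A, nbhs \oo A -> U A.
Proof.
move=> UU U0 A [m _ mA].
have Um : U [set n | (m <= n)%N].
  elim: m {mA} => [|m IH].
    by apply: (@filterS _ U _ setT) => [n _|]; [rewrite /=|exact: filterT].
  have Um : U (~` [set m]).
    have [Um|//] := in_ultra_setVsetC [set m] UU.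
    have : (\bigcap_(A in U) A) m.
      move=> B UB; have [n [Bn nm]] : (B `&` [set m]) !=set0.
        by apply: (@filter_ex _ U); apply: (@filterI _ U).
      by rewrite -(nm : n = m).
    by rewrite U0.
  apply: filterS (filterI IH Um) => n [/= mn nm].
  by rewrite ltn_neqAle mn andbT eq_sym; apply/eqP.
exact: filterS Um.
Qed.

Lemma diameter_ball2 {R : realType} (Z : normedModType R) (U : set Z) :
  (diameter (unit_ball Z `&` U) <= 2%:E)%E.
Proof.
apply: ge_ereal_sup => _ [x [bx _] [y [by_ _] <-]].
rewrite lee_fin (le_trans (ler_normB _ _))//.
by rewrite -[2]/(1 + 1) lerD.
Qed.

Section criterion.
Context {R : realType} {Z : normedModType R}.

(** A uniform form of the diameter two property: each point of norm below [1 + eps]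
    moves in two opposite ways along sequences that are dominated by the basis of
    [c0]. All constants depend on [eps] only, so that the property passes
    to ultrapowers. *)
Context (flip : forall (x : Z) (eps : R), 0 < eps -> `|x| < 1 + eps ->
  exists v w : nat -> Z, [/\
    forall j, `|x + v j| <= 1 + eps,
    forall j, `|x - w j| <= 1 + eps,
    forall j, 2 <= `|v j + w j| &
    forall (a : nat -> R) n, (forall j, `|a j| <= 1) ->
      `|\sum_(j < n) a j *: v j| <= 2 * (1 + eps) /\
      `|\sum_(j < n) a j *: w j| <= 2 * (1 + eps)]).

Lemma ultrapower_norm_le (U : set_system nat) (UU : UltraFilter U)
    (x : linfty Z) (b : nat -> R) (l : R) :
  b n @[n --> U] --> (l : R) -> (forall n, `|x n| <= b n) -> `|upi UU x| <= l.
Proof.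
move=> bl xb; rewrite ultrapower_normE -(cvg_lim (@Rhausdorff R) bl).
apply: ler_lim; [exact: ultra_norm_cvg|by apply/cvg_ex; exists l|exact: nearW].
Qed.

(** The moves of the terms of a representative of [q], made with errors [eps n] that
    tend to zero along [U], define moves of [q] inside the unit ball of the ultrapower,
    and their sequences are weakly null by [c0_sequence_weakly_null]. *)
Lemma uniform_D2P_flip : uniform_D2P Z.
Proof.
move=> U UU U0 W Wop [q [qb Wq]]; apply/eqP; rewrite eq_le diameter_ball2/=.
pose x : linfty Z := repr q.
have qE : upi UU x = q by exact: upi_repr.
(* The second term makes the strict bound in xeps hold, also when q has norm one. *)
pose eps n : R := `| `|x n| - `|q| | + n.+1%:R^-1.
have eps0 : eps n @[n --> U] --> (0 : R).
  rewrite -[0]addr0; apply: cvgD.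
    have := @ultra_norm_cvg _ _ _ UU x; rewrite -ultrapower_normE qE => xq.
    have := cvg_norm (cvgB xq (cvg_cst `|q|)); rewrite subrr normr0. by apply.
  have : (n.+1%:R^-1 : R) @[n --> \oo] --> (0 : R) by exact: cvg_harmonic.
  by move=> h A /h; exact: (free_ultrafilter_oo UU U0).
have xeps n : `|x n| < 1 + eps n.
  rewrite /eps; have : 0 < n.+1%:R^-1 :> R by rewrite invr_gt0.
  have q1 : `|q| <= 1 := qb.
  by have := ler_norm (`|x n| - `|q|); move: (n.+1%:R^-1) => t; lra.
have epsP n : 0 < eps n.
  have h : 0 < n.+1%:R^-1 :> R by rewrite invr_gt0.
  by rewrite /eps (lt_le_trans h)// lerDr.
have /choice[vw vwP] : forall n, exists vw : (nat -> Z) * (nat -> Z), [/\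
    forall j, `|x n + vw.1 j| <= 1 + eps n,
    forall j, `|x n - vw.2 j| <= 1 + eps n,
    forall j, 2 <= `|vw.1 j + vw.2 j| &
    forall (a : nat -> R) m, (forall j, `|a j| <= 1) ->
      `|\sum_(j < m) a j *: vw.1 j| <= 2 * (1 + eps n) /\
      `|\sum_(j < m) a j *: vw.2 j| <= 2 * (1 + eps n)].
  by move=> n; have [v [w h]] := flip (epsP n) (xeps n); exists (v, w).
pose v j n := (vw n).1 j; pose w j n := (vw n).2 j.
have b2 : (2 * (1 + eps n)) @[n --> U] --> (2 : R).
  have := cvgM (cvg_cst (2 : R)) (cvgD (cvg_cst (1 : R)) eps0).
  by rewrite addr0 mulr1; apply.
have bdd (y : nat -> Z) : (forall n, `|y n| <= 2 * (1 + eps n)) -> y \in bounded_seq Z.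
  move=> yb; apply/bounded_seqP; exists (2 * (1 + (`|x| + `|q| + 1))) => n.
  rewrite (le_trans (yb n))// ler_wpM2l// lerD2l lerD//.
    by rewrite (le_trans (ler_normB _ _))// !normr_id lerD// linfty_norm_ub.
  by rewrite invf_le1// ler1n.
have bv j : v j \in bounded_seq Z.
  apply: bdd => n; have [+ _ _ _] := vwP n; move=> /(_ j) h.
  have := ler_normB (x n + v j n) (x n); rewrite addrAC subrr add0r.
  by have := xeps n; rewrite /v; lra.
have bw j : w j \in bounded_seq Z.
  apply: bdd => n; have [_ + _ _] := vwP n; move=> /(_ j) h.
  have := ler_normB (x n - w j n) (x n); rewrite addrAC subrr add0r normrN.
  by have := xeps n; rewrite /w; lra.
pose V j := Linfty (bv j); pose V' j := Linfty (bw j).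
have sumE (Y : nat -> linfty Z) (a : nat -> R) m :
    \sum_(j < m) a j *: upi UU (Y j) = upi UU (\sum_(j < m) a j *: Y j).
  rewrite (big_morph (upi UU) (@upiD _ _ _ UU) (raddf0 _)).
  by apply: eq_bigr => j _; rewrite upiZ.
have sum_at (Y : nat -> linfty Z) (a : nat -> R) m n :
    (\sum_(j < m) a j *: Y j) n = \sum_(j < m) a j *: Y j n.
  by rewrite (big_morph (fun y : linfty Z => y n) (fun y z => linftyD y z n) erefl).
have V0 : forall f : dual (ultrapower Z UU),
    (f (upi UU (V j)) : R^o) @[j --> \oo] --> (0 : R^o).
  apply: (@c0_sequence_weakly_null _ _ _ 2) => a m a1; rewrite sumE.
  apply: ultrapower_norm_le b2 _ => n; rewrite sum_at.
  by have [_ _ _ /(_ a m a1)[]] := vwP n.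
have V'0 : forall f : dual (ultrapower Z UU),
    (f (upi UU (V' j)) : R^o) @[j --> \oo] --> (0 : R^o).
  apply: (@c0_sequence_weakly_null _ _ _ 2) => a m a1; rewrite sumE.
  apply: ultrapower_norm_le b2 _ => n; rewrite sum_at.
  by have [_ _ _ /(_ a m a1)[]] := vwP n.
have WV : \forall j \near \oo, W (q + upi UU (V j)).
  apply: weakly_open_cvg Wop Wq _ => f.
  under eq_fun do rewrite linearD.
  by have := cvgD (cvg_cst (f q : R^o)) (V0 f); rewrite addr0; apply.
have WV' : \forall j \near \oo, W (q - upi UU (V' j)).
  apply: weakly_open_cvg Wop Wq _ => f.
  under eq_fun do rewrite linearB.
  by have := cvgB (cvg_cst (f q : R^o)) (V'0 f); rewrite subr0; apply.
have [j [Wj Wj']] := filter_ex (filterI WV WV').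
have b1 : (1 + eps n) @[n --> U] --> (1 : R).
  by have := cvgD (cvg_cst (1 : R)) eps0; rewrite addr0; apply.
apply: (@le_trans _ _ `|(q + upi UU (V j)) - (q - upi UU (V' j))|%:E).
  rewrite lee_fin opprB [q + _]addrC addrACA subrr addr0 -upiD ultrapower_normE.
  apply: limr_ge; first exact: ultra_norm_cvg.
  by apply: nearW => n; have [_ _ + _] := vwP n; exact.
apply: ereal_sup_ubound; exists (q + upi UU (V j)).
  split=> //; rewrite /unit_ball /= -qE -upiD.
  by apply: ultrapower_norm_le b1 _ => n; have [+ _ _ _] := vwP n; exact.
exists (q - upi UU (V' j)) => //; split=> //; rewrite /unit_ball /= -qE.
have -> : upi UU x - upi UU (V' j) = upi UU (x - V' j).
  by rewrite upiD -[- V' j]scaleN1r upiZ -[- upi UU _]scaleN1r.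
by apply: ultrapower_norm_le b1 _ => n; have [_ + _ _] := vwP n; exact.
Qed.

End criterion.

(** * The renormed space *)

Section renormed_space.
Context {R : realType} {X : normedModType R} (F : c0_frame X).

Local Notation Z := (renormed (c0_renorming F)).
Local Notation e := (vec F).
Local Notation xi := (coord F).

Lemma renormed_normE (x : Z) : `|x| = renorm F x. Proof. by []. Qed.

Lemma renormed_uniform_D2P : uniform_D2P Z.
Proof.
apply: uniform_D2P_flip => x eps eps0 x1.
have [s sP] := renorm_flip x1.
pose k := attach s.
have coefD j : `|phi F (k j) x| <= 1 + eps.
  by rewrite (le_trans (phi_le_renorm F (k j) x))// ltW.
have sumP (b : nat -> R) : (forall j, `|b j| <= 2 * (1 + eps)) ->
    forall (a : nat -> R) n, (forall j, `|a j| <= 1) ->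
    `|\sum_(j < n) a j *: (b j *: e (k j) : Z)| <= 2 * (1 + eps).
  move=> bE a n a1; rewrite renormed_normE (le_trans (renorm_le_box F _))//.
  under eq_bigr do rewrite scalerA.
  apply: (@box_norm_sum _ _ F k (fun j => a j * b j)) => [||j].
  - exact: attach_inj.
  - exact: le_trans (normr_ge0 _) (bE 0%N).
  - by rewrite normrM (le_trans _ (bE j))// ler_piMl.
exists (fun j => (1 + eps - phi F (k j) x) *: e (k j)).
exists (fun j => (1 + eps + phi F (k j) x) *: e (k j)); split.
- by move=> j; have [] := sP j.
- by move=> j; have [] := sP j.
- move=> j; have := phi_le_renorm F (k j) ((1 + eps - phi F (k j) x) *: e (k j) +
    (1 + eps + phi F (k j) x) *: e (k j)).
  rewrite renormed_normE phiD !phiZ phi_vec eqxx; apply: le_trans.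
  by rewrite !mulr1 addrACA addNr addr0 ger0_norm; lra.
- move=> a n a1; split.
    apply: (sumP (fun j => 1 + eps - phi F (k j) x)) => // j.
    by have := coefD j; rewrite !ler_norml; move: (phi F _ _) => p; lra.
  apply: (sumP (fun j => 1 + eps + phi F (k j) x)) => // j.
  by have := coefD j; rewrite !ler_norml; move: (phi F _ _) => p; lra.
Qed.

Lemma coord_continuous k : continuous (xi k : Z -> R^o).
Proof.
have bk : bounded_near (xi k : Z -> R^o) (nbhs (0 : Z)).
  apply/(bounded_funP (xi k : {linear Z -> R^o})) => r.
  exists (3 / 2 * (2 + box_norm F (top F)) * r) => x xr.
  have r0 : 0 <= r := le_trans (normr_ge0 x) xr.
  have u0 := box_norm_ge0 F (top F).
  rewrite (le_trans (coord_le_box F k x))// -[leRHS]mulrA ler_wpM2l//.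
  by rewrite (le_trans (box_le_renorm F x))// ler_wpM2l//; lra.
exact: (bounded_linear_continuous bk).
Qed.

Definition coord_dual k : dual Z := Dual (@coord_continuous k).

Lemma unit_ball_apex s : s != [::] -> unit_ball Z (apex F s).
Proof.
move=> s0; rewrite /unit_ball /= renormed_normE.
rewrite (le_trans (@renorm_le _ _ F 1 s (apex F s) s0))//.
by rewrite scale1r subrr box_norm0 normr1 addr0.
Qed.

(** The supremum of [xi k] over the unit ball is at least its value at [apex [:: k]],
    which is [2] because [node k] has [k]-th coordinate one. *)
Lemma leaf_slice_gt i (delta : R) (k := attach [::] i) (x : Z) :
  slice (unit_ball Z) (coord_dual k) delta x ->
  renorm F x <= 1 /\ 2 - delta < xi k x.
Proof.
move=> [x1 xk]; split=> //; apply: le_lt_trans xk; rewrite lerB//.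
have -> : 2 = coord_dual k (apex F [:: k] : Z) :> R.
  rewrite /= coord_apex avg1 coord_node_diag ?mulr1//.
  exact: coord_vec.
apply: ub_le_sup; last by exists (apex F [:: k]) => //; exact: unit_ball_apex.
have [C C0 fC] := dual_bounded (coord_dual k).
exists C => _ [y y1 <-]; rewrite (le_trans (ler_norm _))// (le_trans (fC y))//.
by rewrite ler_piMr// ltW.
Qed.

(** Each [x i] and [y i] is replaced by a nearby point [apex (s i)] or [apex (t i)], at a
    cost proportional to [delta]. The mean of the differences of these points is twice a
    mean of differences of averages, which [leaf_slices_mean] bounds. *)
Lemma leaf_slices_diameter (N : nat) (delta : R) (x y : 'I_N.+1 -> Z) :
  0 < delta -> delta < 5^-1 ->
  (forall i : 'I_N.+1, slice (unit_ball Z) (coord_dual (attach [::] i)) delta (x i)) ->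
  (forall i : 'I_N.+1, slice (unit_ball Z) (coord_dual (attach [::] i)) delta (y i)) ->
  renorm F (\sum_i N.+1%:R^-1 *: x i - \sum_i N.+1%:R^-1 *: y i) <=
    (52 + 14 * box_norm F (top F)) * delta + 2 / N.+1%:R.
Proof.
move=> d0 d1 xS yS.
have near (z : 'I_N.+1 -> Z) :
    (forall i : 'I_N.+1, slice (unit_ball Z) (coord_dual (attach [::] i)) delta (z i)) ->
  exists s : 'I_N.+1 -> seq nat, forall i : 'I_N.+1, [/\ s i != [::],
    1 - 6 * delta <= xi (attach [::] i) (avg e (s i)) &
    renorm F (z i - apex F (s i)) <= (20 + 7 * box_norm F (top F)) * delta].
  move=> zS; have /choice : forall i : 'I_N.+1, exists s, [/\ s != [::],
    1 - 6 * delta <= xi (attach [::] i) (avg e s) &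
    renorm F (z i - apex F s) <= (20 + 7 * box_norm F (top F)) * delta].
    by move=> i; have [z1 zk] := leaf_slice_gt (zS i); exact: slice_near_apex.
  by move=> [s sP]; exists s.
have [s sP] := near x xS; have [t tP] := near y yS.
pose K := (20 + 7 * box_norm F (top F)) * delta.
have N0 : 0 < N.+1%:R^-1 :> R by rewrite invr_gt0.
have mean_near (z : 'I_N.+1 -> X) : (forall i, renorm F (z i) <= K) ->
    renorm F (\sum_i N.+1%:R^-1 *: z i) <= K.
  move=> zK; have le_sum : renorm F (\sum_i N.+1%:R^-1 *: z i) <=
      \sum_i N.+1%:R^-1 * renorm F (z i).
    elim/big_ind2 : _ => [|a b a' b' ab ab'|i _].
    - by rewrite sublinear0//; exact: renorm_sublinear.
    - by rewrite (le_trans (renormD F _ _))// lerD.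
    - by rewrite renormZ gtr0_norm.
  rewrite (le_trans le_sum)// -mulr_sumr ler_pdivrMl//.
  rewrite -[N.+1 in leRHS]card_ord mulr_natl -sumr_const.
  by apply: ler_sum.
have avg_near : renorm F (\sum_i N.+1%:R^-1 *: (apex F (s i) - apex F (t i))) <=
    12 * delta + 2 / N.+1%:R.
  rewrite (le_trans (renorm_le_box F _))//; apply: box_norm_null.
  - elim/big_ind: _ => [||i _]; [exact: null0|exact: nullD|].
    apply: nullZ; rewrite apexB; apply: nullZ; apply: nullD; last apply: nullN.
      exact: null_avg.
    exact: null_avg.
  - by apply: addr_ge0; [apply: mulr_ge0 (ltW d0)|apply: mulr_ge0 (ltW N0)].
  - move=> j; rewrite linear_sum.
    have d60 : 0 <= 6 * delta by lra.
    have := @leaf_slices_mean _ _ e xi (coord_vec F) N.+1 s t (6 * delta) j d60.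
    have s1 i : s i != [::] by case: (sP i).
    have t1 i : t i != [::] by case: (tP i).
    have s2 (i : 'I_N.+1) : 1 - 6 * delta <= xi (attach [::] i) (avg e (s i)).
      by case: (sP i).
    have t2 (i : 'I_N.+1) : 1 - 6 * delta <= xi (attach [::] i) (avg e (t i)).
      by case: (tP i).
    move=> /(_ s1 t1 s2 t2) h.
    rewrite (le_trans (ler_norm_sum _ _ _))//.
    rewrite (eq_bigr (fun i => N.+1%:R^-1 * 2 *
      `|(xi j (avg e (s i)) : R) - xi j (avg e (t i))|)) => [|i _]; last first.
      rewrite apexB linearZ/= linearZ/= linearB/= !normrM (gtr0_norm N0).
      by rewrite [`|2|]ger0_norm// mulrA.
    rewrite -mulr_sumr -mulrA ler_pdivrMl//; move: h.
    move: (\sum_(_ < _) _) => S h.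
    have -> : N.+1%:R * (12 * delta + 2 / N.+1%:R) =
      2 * (N.+1%:R * (6 * delta) + 1) by field.
    by rewrite ler_wpM2l.
have -> : \sum_i N.+1%:R^-1 *: x i - \sum_i N.+1%:R^-1 *: y i =
    \sum_i N.+1%:R^-1 *: (x i - apex F (s i) : X) -
    \sum_i N.+1%:R^-1 *: (y i - apex F (t i) : X) +
    \sum_i N.+1%:R^-1 *: (apex F (s i) - apex F (t i)).
  rewrite -!sumrB -big_split/=; apply: eq_bigr => i _.
  rewrite -!scalerBr -scalerDr; congr (_ *: _).
  move: (x i : X) (y i : X) (apex F (s i)) (apex F (t i)) => a b c d.
  by rewrite opprB addrAC !subrKA.
have /= xK := mean_near (fun i => x i - apex F (s i))
  (fun i => let: And3 _ _ h := sP i in h).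
have /= yK := mean_near (fun i => y i - apex F (t i))
  (fun i => let: And3 _ _ h := tP i in h).
move: avg_near xK yK.
move: (\sum_i _ *: (apex F (s i) - _)) (\sum_i _ *: (x i - _)) (\sum_i _ *: (y i - _)).
move=> a b c aP bP cP.
have := renormD F (b - c) a; have := renormD F b (- c); rewrite renormN.
move: aP bP cP; rewrite /K; move: (2 / _) => h; lra.
Qed.

Lemma renormed_small_combination (eta : R) : 0 < eta ->
  exists2 A : set Z, convex_combination_of_slices (unit_ball Z) A &
    (diameter A < eta%:E)%E.
Proof.
move=> eta0; pose K := 52 + 14 * box_norm F (top F).
have K0 : 0 < K by have := box_norm_ge0 F (top F); rewrite /K; lra.
pose delta := Num.min (6^-1) (eta / (4 * K)).
have d0 : 0 < delta by rewrite lt_min invr_gt0 ltr0n divr_gt0// mulr_gt0.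
have d1 : delta < 5^-1.
  by apply: (@le_lt_trans _ _ 6^-1); [rewrite ge_min lexx|lra].
have dK : K * delta <= eta / 4.
  have : delta <= eta / (4 * K) by rewrite ge_min lexx orbT.
  rewrite ler_pdivlMr; last by lra.
  by lra.
pose N := Num.trunc (8 / eta).
have NP : 2 / N.+1%:R <= eta / 4.
  rewrite ler_pdivrMr//; have := truncnS_gt (8 / eta); rewrite ltr_pdivrMr// -/N.
  by move: (N.+1%:R) => n; lra.
exists [set \sum_i N.+1%:R^-1 *: x i | x in [set x : 'I_N.+1 -> Z |
    forall i : 'I_N.+1, slice (unit_ball Z) (coord_dual (attach [::] i)) delta (x i)]].
  exists N.+1, (fun=> N.+1%:R^-1),
    (fun i : 'I_N.+1 => slice (unit_ball Z) (coord_dual (attach [::] i)) delta).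
  split=> // [i||i].
  - by rewrite invr_gt0 ltr0n invf_le1// ler1n.
  - by rewrite sumr_const card_ord -[LHS]mulr_natl mulfV.
  - by exists (coord_dual (attach [::] i)), delta.
apply: (@le_lt_trans _ _ (eta / 2)%:E); last by rewrite lte_fin; lra.
apply: ge_ereal_sup => _ [_ [x xS <-] [_ [y yS <-] <-]].
rewrite lee_fin renormed_normE (le_trans (leaf_slices_diameter d0 d1 xS yS))//.
by rewrite (le_trans (lerD dK NP))//; lra.
Qed.

End renormed_space.

(** * Spaces containing a copy of [c0] *)

Section c0_unit_vectors.
Context {R : realType}.

Lemma delta_bounded n : (fun i : nat => (i == n)%:R : R^o) \in bounded_seq R^o.
Proof.
apply/bounded_seqP; exists 1 => i.
by case: (i == n); rewrite ?normr1// normr0.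
Qed.

Lemma delta_c0 n : Linfty (delta_bounded n) \in @c0_seq R.
Proof.
apply/c0_seqP; apply: cvg_near_cst; exists n.+1 => // i /= ni.
by rewrite gtn_eqF.
Qed.

Definition delta n : c0 R := C0 (delta_c0 n).

Definition c0_coord n (v : c0 R) : R^o := c0_val v n.

Lemma c0_coord_linear n : linear (c0_coord n).
Proof. by []. Qed.

HB.instance Definition _ n :=
  GRing.isLinear.Build R (c0 R) R^o *:%R (c0_coord n) (c0_coord_linear n).

Lemma c0_coord_le n v : `|c0_coord n v : R| <= `|v|.
Proof. exact: (linfty_norm_ub (c0_val v) n). Qed.

Lemma c0_norm_le (v : c0 R) m : (forall n, `|c0_coord n v : R| <= m) -> `|v| <= m.
Proof. exact: linfty_norm_le. Qed.

End c0_unit_vectors.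

(** The coordinate functionals of [c0] extend to [X] with a common bound. The image of
    the zeroth unit vector serves as [top] and its coordinate as [limit], which amounts
    to the usual isomorphism of [c0] with the space of convergent sequences. If [dist x]
    and the coordinates of [x] are small, then so are those of a vector [v] of [c0] whose
    image is close to [x], hence [v] and [x] are small. *)
Lemma c0_frame_of_copy {R : realType} (X : normedModType R) :
  contains_isomorphic_copy X (c0 R) -> inhabited (c0_frame X).
Proof.
move=> [T [a [C [a0 C0 TP]]]].
have aV0 : 0 < a^-1 by rewrite invr_gt0.
have Tlow v : `|v| <= a^-1 * `|T v|.
  by rewrite ler_pdivlMl//; case/andP: (TP v).
have Tup v : `|T v| <= C * `|v| by case/andP: (TP v).
have /choice[f fP] : forall n, exists f : {linear X -> R^o},
    (forall v, f (T v) = c0_coord n v) /\ forall x, `|f x : R| <= a^-1 * `|x|.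
  move=> n; apply: hahn_banach_extension => [|v]; first exact: ltW.
  exact: le_trans (c0_coord_le n v) (Tlow v).
pose G (v : {v : c0 R | c0_coord 0 v = 0}) (x : X) := `|x - T (sval v)|.
have G_lb x : exists m, forall v, m <= G v x by exists 0 => v; exact: normr_ge0.
have cz : c0_coord 0 (0 : c0 R) = 0 by [].
pose z : {v : c0 R | c0_coord 0 v = 0} := exist _ 0 cz.
have Gz x : G z x = `|x| by rewrite /G /= !linear0 addr0.
have sG : sublinear (inf_fun G).
  apply: inf_fun_sublinear => //.
  - by exists z; rewrite Gz normr0.
  - move=> [v v0] [w w0] x y eps eps0.
    have vw0 : c0_coord 0 (v + w) = 0.
      by rewrite -[LHS]/((c0_coord 0 v : R) + c0_coord 0 w) v0 w0 addr0.
    exists (exist _ (v + w) vw0); rewrite /G/= (linearD T) opprD addrACA.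
    by have := ler_normD (x - T v) (y - T w); lra.
  - move=> [v v0] b x b0.
    have bv0 : c0_coord 0 (b *: v) = 0.
      by rewrite -[LHS]/(b * (c0_coord 0 v : R)) v0 mulr0.
    exists (exist _ (b *: v) bv0); rewrite /G/= linearZ/= -scalerBr normrZ.
    by rewrite gtr0_norm.
have GN x : inf_fun G (- x) <= inf_fun G x.
  apply: (inf_fun_ge z) => -[v v0].
  have Nv0 : c0_coord 0 (- v) = 0 by rewrite -[LHS]/(- (c0_coord 0 v : R)) v0 oppr0.
  rewrite (le_trans (inf_fun_le G_lb (exist _ (- v) Nv0) _))// /G/=.
  by rewrite (linearN T) -opprD normrN.
have G0 x : 0 <= inf_fun G x by apply: (inf_fun_ge z) => v; exact: normr_ge0.
constructor.
apply: (@C0Frame _ _ (fun k => T (delta k.+1)) (T (delta 0)) (fun j => f j.+1) (f 0%N)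
  (inf_fun G)).
- by move=> j k; rewrite (fP _).1.
- by move=> j; rewrite (fP _).1.
- by move=> k; rewrite (fP _).1.
- by rewrite (fP _).1.
- exact: sG.1.
- exact: sublinear_normZ.
- move=> k; apply/eqP; rewrite eq_le G0 andbT.
  have d0 : c0_coord 0 (delta k.+1 : c0 R) = 0 by [].
  by rewrite (le_trans (inf_fun_le G_lb (exist _ _ d0) _))// /G/= subrr normr0.
- exists (1 + a^-1); first by rewrite addr_gt0.
  move=> x; have x0 := normr_ge0 x.
  have ax : a^-1 * `|x| <= (1 + a^-1) * `|x| by rewrite mulrDl lerDr mul1r.
  split=> [||j]; [|by rewrite (le_trans ((fP _).2 x))|by rewrite (le_trans ((fP _).2 x))].
  rewrite (le_trans (inf_fun_le G_lb z x))// Gz mulrDl mul1r lerDl.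
  by rewrite mulr_ge0// ltW.
- pose D := 1 + C * a^-1.
  have Ca : 0 < C * a^-1 by rewrite mulr_gt0.
  exists (C + D); first by rewrite /D; lra.
  move=> x r xr _ coordr; apply/ler_addgt0Pr => eps eps0.
  have e1 : 0 < eps / D by rewrite divr_gt0// /D; lra.
  have [|[v v0] vx] := @inf_fun_lt _ _ _ G (r + eps / D) x z; first by lra.
  have {}vx : `|x - T v| < r + eps / D by [].
  have r0 : 0 <= r := le_trans (G0 x) xr.
  have vr : `|v| <= r + a^-1 * (r + eps / D).
    apply: c0_norm_le => -[|n].
      by rewrite v0 normr0 addr_ge0// mulr_ge0 ?(ltW aV0)// (le_trans _ (ltW vx)).
    rewrite -(fP n.+1).1 -[T v](subKr x) linearB/= (le_trans (ler_normB _ _))// lerD//.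
    by rewrite (le_trans ((fP _).2 _))// ler_wpM2l ?(ltW aV0)// ltW.
  have := le_trans (Tup v) (ler_wpM2l (ltW C0) vr).
  have := ler_normD (x - T v) (T v); rewrite subrK.
  have : D * (eps / D) = eps by rewrite mulrC divfK// gt_eqF// /D; lra.
  move: vx; rewrite /D; move: (a^-1) (eps / _) => b e'.
  nra.
Qed.

Theorem theorem1p2 (R : realType) (X : completeNormedModType R)
    (hX : contains_isomorphic_copy X (c0 R)) :
  exists N : equivalent_norm X,
    uniform_D2P (renormed N) /\
    forall eta : R, 0 < eta ->
      exists2 A : set (renormed N),
        convex_combination_of_slices (unit_ball (renormed N)) A &
        (diameter A < eta%:E)%E.
Proof.
have [F] := c0_frame_of_copy hX.
exists (c0_renorming F); split; first exact: renormed_uniform_D2P.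
exact: renormed_small_combination.
Qed.
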